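(* Let $\mu$ be a partition of $n+1$ and let $(i,j)\in\mu$ be a cell of its diagram. Let $\ell$ be the largest row index $r$ such that $(r,j)\in\mu$. Then $$\dim M^0_{\mu/i,j}=\frac{n!}{\mu!}\,\big|\{(r,c)\in\mu\ :\ i\le r\le \ell\}\big|.$$
   Context: **Diagrams.** A lattice diagram is a finite subset $D\subset\mathbb N\times\mathbb N$ (with $0\in\mathbb N$); its elements $(r,c)$ are cells, with $r$ the row index and $c$ the column index (both starting at $0$). A partition $\mu=(\mu_1\ge\mu_2\ge\cdots\ge\mu_k>0)$ is identified with its diagram $\{(r,c): 0\le r\le k-1,\ 0\le c\le \mu_{r+1}-1\}$, and $\mu!:=\mu_1!\,\mu_2!\cdots\mu_k!$. For $(i,j)\in\mu$, $\mu/i,j$ denotes the lattice diagram $\mu\setminus\{(i,j)\}$. **Spaces.** For $D=\{(r_1,c_1),\ldots,(r_n,c_n)\}$ with $n$ cells, listed in increasing lexicographic order, and variables $X=x_1,\ldots,x_n$, $Y=y_1,\ldots,y_n$, put $\Delta_D(X;Y)=\det\|x_s^{r_t}y_s^{c_t}\|_{s,t=1}^n\in\mathbb Q[X,Y]$. $M_D$ is the $\mathbb Q$-linear span of all partial derivatives, of all orders (including order $0$) and with respect to all the variables, of $\Delta_D$. It is bigraded by degree in $X$ and degree in $Y$; $M_D^0$ is its $Y$-free component, i.e. the subspace of elements of degree $0$ in $Y$. *)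

(* Defs.v *)
From HB Require Import structures.
From mathcomp Require Import all_boot all_order all_algebra.
From mathcomp Require Import finmap.
From mathcomp.multinomials Require Import mpoly.

Set Implicit Arguments.
Unset Strict Implicit.
Unset Printing Implicit Defensive.

Import Order.TTheory GRing.Theory Num.Theory.

Local Open Scope ring_scope.

(* U is a subspace of V of finite dimension d: it has a basis of d elements.
   {mpoly rat[k]} is not a vectType, so \dim does not apply to it. *)
Definition is_dim (K : fieldType) (V : lmodType K) (U : V -> Prop) (d : nat) :
    Prop :=
  exists b : 'I_d -> V,
    (forall a : 'I_d -> K, \sum_(k < d) a k *: b k = 0 -> forall k, a k = 0) /\
    (forall v : V, U v <-> exists a : 'I_d -> K, v = \sum_(k < d) a k *: b k).

(* A cell is (r, c) = (row, column), both counted from 0. *)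
Notation diagram := {fset (nat * nat)%type}.

Definition cells (D : diagram) : seq (nat * nat) :=
  sort (fun a b : nat *l nat => (a <= b)%O) (enum_fset D).

Definition is_partition (mu : seq nat) (m : nat) : Prop :=
  [/\ sorted geq mu, all (fun k => 0 < k)%N mu & sumn mu = m].

Definition part_diagram (mu : seq nat) : diagram :=
  [fset rc in [seq (r, c) | r <- iota 0 (size mu), c <- iota 0 (nth 0%N mu r)]]%fset.

Definition part_fact (mu : seq nat) : nat := (\prod_(k <- mu) k`!)%N.

Section Spaces.

Variable D : diagram.

Let n := #|` D|.

(* The variables of {mpoly rat[n + n]} are x_0, ..., x_(n-1) followed by
   y_0, ..., y_(n-1). *)
Definition xvar (s : 'I_n) : {mpoly rat[n + n]} := 'X_(lshift n s).
Definition yvar (s : 'I_n) : {mpoly rat[n + n]} := 'X_(rshift n s).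

Definition lattice_det : {mpoly rat[n + n]} :=
  \det (\matrix_(s < n, t < n)
          (xvar s ^+ (nth (0, 0)%N (cells D) t).1 *
           yvar s ^+ (nth (0, 0)%N (cells D) t).2)).

(* For e : 'X_{1..n + n}, p^`M[e] is the iterated partial derivative of p,
   taken e k times with respect to the k-th variable. *)
Definition M_space (p : {mpoly rat[n + n]}) : Prop :=
  exists (N : nat) (a : 'I_N -> rat) (e : 'I_N -> 'X_{1..n + n}),
    p = \sum_(k < N) a k *: lattice_det^`M[e k].

Definition ydeg (m : 'X_{1..n + n}) : nat := (\sum_(s < n) m (rshift n s))%N.

Definition M0_space (p : {mpoly rat[n + n]}) : Prop :=
  M_space p /\ {in msupp p, forall m, ydeg m = 0%N}.

End Spaces.

Arguments M_space D p : clear implicits.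
Arguments M0_space D p : clear implicits.

(* Main.v *)
Require Import Defs.
From HB Require Import structures.
From mathcomp Require Import all_boot all_order all_fingroup all_algebra.
From mathcomp Require Import finmap.
From mathcomp.multinomials Require Import mpoly.
From mathcomp Require Import zify.

Set Implicit Arguments.
Unset Strict Implicit.
Unset Printing Implicit Defensive.

Import Order.TTheory GRing.Theory Num.Theory.
Local Open Scope ring_scope.

(** Let [h c] be the height of column [c] of [mu] and [mu_r] the length of row
    [r]. Put [n + 1] variables on the cells of [mu]; the product over the columns
    of the Vandermonde determinants of the variables they receive generates, under
    derivation, a space [V(h)] of polynomials. Setting [B_t = sum_r min(t, mu_r)],
    every [F] in [V(h)] is annihilated by [e_r(d/dx_s, s in S)] as soon as
    [B_t < r + t], [t] being the number of variables outside [S] (Tanisaki's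
    relations). Let [U(h)] be the space of polynomials satisfying them.

    Expand [F] in powers of one variable [z]. If the coefficient of [z^(k+1)]
    vanishes, that of [z^k] (up to a factorial) lies in [U(h - e_c)], where [c] is
    a shortest column with more than [k] cells; the generators of [V(h - e_c)]
    occur in this way. Since the last row of [c] has length [mu_k], induction gives
    [dim U(h) <= n! / mu! <= dim V(h)] for [n] variables.

    The [Y]-free component for [mu / i,j] is the space [P_i] of coefficients of
    [z^i] in the polynomials generated by the products in which [z] sits in column
    [j]. The relation [e_1 = 0] gives [e_1(d/dx) P_k = P_(k+1)], and by the previous
    paragraph the kernel of [e_1(d/dx)] on [P_k] lies in [U(h - e_c)]. It contains
    [V(h - e_c)] because a Garnir relation moves [z] from column [c] to the column
    [j], which is at least as high. Hence
    [dim P_k = dim P_(k+1) + n! mu_k / mu!], and [P_(l+1) = 0]. *)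

(** * Polynomials with normalized coefficients *)

Section Box.
Variables (m N : nat).
Implicit Types (s z : 'I_m) (X S T : {set 'I_m}).

Definition expo := {ffun 'I_m -> nat}.
(* [F : coeffs] stands for the polynomial in [x_0, ..., x_(m-1)] whose coefficient
   at [x^A] is [F A / A!], so that derivations act as shifts of exponents; all
   exponents are at most [N]. *)
Definition coeffs := {ffun {ffun 'I_m -> 'I_N.+1} -> rat^o}.
Implicit Types (A e : expo) (F G : coeffs).

Definition in_box A := [forall s, A s <= N]%N.

Lemma in_boxP A : reflect (forall s, A s <= N)%N (in_box A).
Proof. exact: forallP. Qed.

(** Exponents outside the box read as [0], so that shifting exponents needs no side condition. *)
Definition ev F A : rat :=
  if in_box A then F [ffun s => inord (A s)] else 0.

Definition tabulate (phi : expo -> rat) : coeffs :=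
  [ffun a : {ffun 'I_m -> 'I_N.+1} => phi [ffun s => a s : nat]].

Lemma ev_tabulate phi A : (phi A != 0 -> in_box A) -> ev (tabulate phi) A = phi A.
Proof.
move=> hA; rewrite /ev; case: ifPn => [/in_boxP bA|nA].
  rewrite ffunE; congr phi; apply/ffunP => s; rewrite !ffunE inordK //.
  by rewrite ltnS.
by apply/esym/eqP; apply: contraNT nA.
Qed.

Lemma ev_neq0 F A : ev F A != 0 -> in_box A.
Proof. by rewrite /ev; case: ifP => //; rewrite eqxx. Qed.

Lemma evP F G : ev F =1 ev G -> F = G.
Proof.
move=> eqFG; apply/ffunP => a.
have := eqFG [ffun s => a s : nat]; rewrite /ev.
have -> : in_box [ffun s => a s : nat].
  by apply/in_boxP => s; rewrite ffunE -ltnS.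
suff -> : [ffun s => inord ([ffun s => a s : nat] s)] = a by [].
by apply/ffunP => s; rewrite !ffunE inord_val.
Qed.

Lemma ev_linear A : linear (ev^~ A : coeffs -> rat^o).
Proof.
move=> a F G; rewrite /ev; case: ifP => _; last by rewrite scaler0 addr0.
by rewrite !ffunE.
Qed.

Lemma evD F G A : ev (F + G) A = ev F A + ev G A.
Proof. by have := ev_linear A 1 F G; rewrite !scale1r. Qed.

Lemma ev0 A : ev 0 A = 0.
Proof. by rewrite /ev; case: ifP => // _; rewrite ffunE. Qed.

Lemma evZ a F A : ev (a *: F) A = a * ev F A.
Proof. by have := ev_linear A a F 0; rewrite !addr0 ev0 addr0. Qed.

Lemma ev_sum (J : Type) (r : seq J) (P : pred J) (F : J -> coeffs) A :
  ev (\sum_(k <- r | P k) F k) A = \sum_(k <- r | P k) ev (F k) A.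
Proof.
by apply: (big_morph (ev^~ A)) => [F1 F2|]; rewrite ?evD ?ev0.
Qed.

Lemma evN F A : ev (- F) A = - ev F A.
Proof. by rewrite -scaleN1r evZ mulN1r. Qed.

Definition addx A e : expo := [ffun s => A s + e s]%N.
Definition inc T A : expo := [ffun s => A s + (s \in T)]%N.
Definition upd z k A : expo := [ffun s => if s == z then k else A s].

Lemma in_box_addx A e : in_box (addx A e) -> in_box A.
Proof.
move/in_boxP=> h; apply/in_boxP => s; have := h s; rewrite ffunE.
exact/leq_trans/leq_addr.
Qed.

Lemma upd_inc z k T A : z \notin T -> upd z k (inc T A) = inc T (upd z k A).
Proof.
move=> zT; apply/ffunP => s; rewrite !ffunE; case: eqP => // ->.
by rewrite (negbTE zT) addn0.
Qed.

Lemma upd_id z A : upd z (A z) A = A.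
Proof. by apply/ffunP => s; rewrite !ffunE; case: eqP => // ->. Qed.

Lemma upd_upd z k k' A : upd z k (upd z k' A) = upd z k A.
Proof. by apply/ffunP => s; rewrite !ffunE; case: eqP. Qed.

(** This is [k!] times the coefficient of the [k]-th power of the variable [z], kept in the same
    space as a polynomial of degree [0] in [z]. *)
Definition slice z k F : coeffs :=
  tabulate (fun A => if A z == 0%N then ev F (upd z k A) else 0).

Lemma ev_slice z k F A :
  ev (slice z k F) A = if A z == 0%N then ev F (upd z k A) else 0.
Proof.
apply: ev_tabulate; case: (A z =P 0%N) => [Az0 /ev_neq0/in_boxP h|]; last by rewrite eqxx.
apply/in_boxP => s; have := h s; rewrite ffunE; case: (s =P z) => // -> _.
by rewrite Az0.
Qed.

Lemma slice_linear z k : linear (slice z k).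
Proof.
move=> a F G; apply: evP => A; rewrite evD evZ !ev_slice evD evZ.
by case: ifP => // _; rewrite mulr0 addr0.
Qed.
HB.instance Definition _ z k :=
  GRing.isLinear.Build rat coeffs coeffs _ (slice z k) (slice_linear z k).

Definition shift e F : coeffs := tabulate (fun A => ev F (addx A e)).

Lemma ev_shift e F A : ev (shift e F) A = ev F (addx A e).
Proof. by apply: ev_tabulate => /ev_neq0/in_box_addx. Qed.

Lemma shift_linear e : linear (shift e).
Proof. by move=> a F G; apply: evP => A; rewrite evD evZ !ev_shift evD evZ. Qed.
HB.instance Definition _ e :=
  GRing.isLinear.Build rat coeffs coeffs _ (shift e) (shift_linear e).

(* The elementary symmetric function [e_r(d/dx_s, s in S)] applied to [F]. *)
Definition elsym S r F : coeffs :=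
  tabulate (fun A => \sum_(T : {set 'I_m} | (T \subset S) && (#|T| == r)) ev F (inc T A)).

Lemma ev_elsym S r F A :
  ev (elsym S r F) A =
  \sum_(T : {set 'I_m} | (T \subset S) && (#|T| == r)) ev F (inc T A).
Proof.
apply: ev_tabulate; apply: contraNT => nA; apply/eqP/big1 => T _.
apply/eqP; apply: contraNT nA => /ev_neq0/in_boxP h; apply/forallP => s.
by have := h s; rewrite ffunE; apply/leq_trans/leq_addr.
Qed.

Lemma elsym_linear S r : linear (elsym S r).
Proof.
move=> a F G; apply: evP => A; rewrite evD evZ !ev_elsym mulr_sumr -big_split /=.
by apply: eq_bigr => T _; rewrite evD evZ.
Qed.
HB.instance Definition _ S r :=
  GRing.isLinear.Build rat coeffs coeffs _ (elsym S r) (elsym_linear S r).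

Lemma elsym0 S F : elsym S 0 F = F.
Proof.
apply: evP => A; rewrite ev_elsym (big_pred1 set0) => [|T].
  by congr ev; apply/ffunP => s; rewrite ffunE inE addn0.
by rewrite cards_eq0 andbC /=; case: eqP => [->|] //=; rewrite sub0set.
Qed.

(** Sort the subsets of [z |: S] by whether they contain [z]; those that do contribute one
    derivation in [z]. *)
Lemma ev_elsymS z S r F A : z \notin S ->
  ev (elsym (z |: S) r.+1 F) A =
  ev (elsym S r.+1 F) A + ev (elsym S r F) (inc [set z] A).
Proof.
move=> zS; rewrite !ev_elsym (bigID (fun T : {set 'I_m} => z \notin T)) /=.
congr (_ + _).
  apply: eq_bigl => T; rewrite andbAC; congr (_ && _).
  have -> : S = (z |: S) :\ z by rewrite setU1K.
  by rewrite subsetD1 setU1K.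
rewrite (reindex_onto (fun T => z |: T) (fun T => T :\ z)) /= => [|T]; last first.
  by case/andP=> _; rewrite negbK => zT; rewrite setD1K.
apply: eq_big => [T|T].
  rewrite !inE eqxx /= andbT.
  have [zT|zT] := boolP (z \in T).
    have -> : (z |: T) :\ z == T = false.
      by apply/negP => /eqP/setP/(_ z); rewrite !inE eqxx zT.
    rewrite andbF; apply/esym/negbTE; apply: contra zS => /andP[/subsetP h _].
    exact: h.
  rewrite setU1K // eqxx andbT cardsU1 zT add1n eqSS; congr (_ && _).
  apply/idP/idP => [/subsetP h|h]; last exact: setUS.
  apply/subsetP => x xT; have := h x; rewrite !inE xT orbT => /(_ isT).
  by case/orP => // /eqP xz; rewrite xz (negbTE zT) in xT.
case/andP=> _ /eqP eT; congr ev; apply/ffunP => s; rewrite !ffunE !inE -addnA.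
congr addn; case: (s =P z) => //= ->.
by have /setP/(_ z) := eT; rewrite !inE eqxx /= => <-.
Qed.

Lemma elsym_slice z k S r F A : z \notin S -> A z = 0%N ->
  ev (elsym S r (slice z k F)) A = ev (elsym S r F) (upd z k A).
Proof.
move=> zS Az; rewrite !ev_elsym; apply: eq_bigr => T /andP[/subsetP TS _].
have zT : z \notin T by apply: contra zS; exact: TS.
by rewrite ev_slice ffunE Az (negbTE zT) /= upd_inc.
Qed.

Lemma elsym_slice0 z k S r F A : z \notin S -> A z != 0%N ->
  ev (elsym S r (slice z k F)) A = 0.
Proof.
move=> zS Az; rewrite ev_elsym; apply: big1 => T _.
by rewrite ev_slice ffunE addn_eq0 (negbTE Az).
Qed.

Lemma shift_slice z k e F : e z = 0%N ->
  shift e (slice z k F) = slice z k (shift e F).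
Proof.
move=> ez; apply: evP => A; rewrite !(ev_slice, ev_shift) ffunE ez addn0.
case: ifP => // _; congr ev; apply/ffunP => s; rewrite !ffunE.
by case: eqP => // ->; rewrite ez addn0.
Qed.

Lemma shift_shift e e' F : shift e (shift e' F) = shift (addx e e') F.
Proof.
apply: evP => A; rewrite !ev_shift; congr ev; apply/ffunP => s.
by rewrite !ffunE addnA.
Qed.

Lemma slice_overflow z k F : (N < k)%N -> slice z k F = 0.
Proof.
move=> ltNk; apply: evP => A; rewrite ev_slice ev0; case: ifP => // _.
apply/eqP; apply: contraTT ltNk => /ev_neq0/in_boxP/(_ z).
by rewrite ffunE eqxx -leqNgt.
Qed.

Lemma slice_inj z F : (forall k, slice z k F = 0) -> F = 0.
Proof.
move=> F0; apply: evP => A; rewrite ev0.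
have := congr1 (ev^~ (upd z 0 A)) (F0 (A z)).
by rewrite ev0 ev_slice ffunE eqxx upd_upd upd_id.
Qed.

Lemma elsym_shift S r F :
  elsym S r F =
  \sum_(T : {set 'I_m} | (T \subset S) && (#|T| == r)) shift (inc T [ffun => 0%N]) F.
Proof.
apply: evP => A; rewrite ev_elsym ev_sum; apply: eq_bigr => T _.
by rewrite ev_shift; congr ev; apply/ffunP => s; rewrite !ffunE.
Qed.

(* The elements of [W] of degree less than [k] in the variable [z]. *)
Definition low_part z (W : {vspace coeffs}) k : {vspace coeffs} :=
  (W :&: \bigcap_(a < N.+1 | (k <= a)%N) lker (linfun (slice z a)))%VS.

Lemma mem_low_part z (W : {vspace coeffs}) k F :
  reflect (F \in W /\ forall a, (k <= a)%N -> slice z a F = 0)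
          (F \in low_part z W k).
Proof.
rewrite memv_cap; apply: (iffP andP) => [[FW FK]|[FW F0]].
  split=> // a leka; case: (leqP a N) => [leaN|]; last exact: slice_overflow.
  move: FK; rewrite memvE => /subv_bigcapP/(_ (Ordinal (leaN : a < N.+1)%N) leka).
  by rewrite -memvE memv_ker lfunE /= => /eqP.
split=> //; rewrite memvE; apply/subv_bigcapP => a leka.
by rewrite -memvE memv_ker lfunE /= F0.
Qed.

(** Filter [W] by the degree in [z]: on [low_part z W k.+1] the kernel of the slice at [k] is
    [low_part z W k], so rank-nullity telescopes. *)
Lemma dim_slices z (W : {vspace coeffs}) :
  \dim W =
  (\sum_(k < N.+1) \dim (linfun (slice z k) @: low_part z W k.+1))%N.
Proof.
have low0 : low_part z W 0 = 0%VS.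
  apply/eqP; rewrite -subv0; apply/subvP => F /mem_low_part[_ F0].
  by rewrite memv0; apply/eqP/(@slice_inj z) => k; apply: F0.
have lowN : low_part z W N.+1 = W.
  apply/eqP; rewrite eqEsubv capvSl; apply/subvP => F FW; apply/mem_low_part.
  by split=> // a; apply: slice_overflow.
have lowS k : low_part z W k = (low_part z W k.+1 :&: lker (linfun (slice z k)))%VS.
  apply/eqP; rewrite eqEsubv; apply/andP; split; apply/subvP => F.
    case/mem_low_part=> FW F0; rewrite memv_cap memv_ker lfunE /= F0 // eqxx andbT.
    by apply/mem_low_part; split=> // a /ltnW; apply: F0.
  rewrite memv_cap memv_ker lfunE /= => /andP[/mem_low_part[FW F0] /eqP Fk].
  apply/mem_low_part; split=> // a; rewrite leq_eqVlt => /orP[/eqP<-//|].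
  exact: F0.
suff dim_low k : \dim (low_part z W k) =
    (\sum_(a < k) \dim (linfun (slice z a) @: low_part z W a.+1))%N.
  by rewrite -[in LHS]lowN dim_low.
elim: k => [|k IHk]; first by rewrite low0 dimv0 big_ord0.
by rewrite -(limg_ker_dim (linfun (slice z k))) -lowS IHk big_ord_recr.
Qed.

End Box.

Arguments ev {m N}.
Arguments tabulate {m N}.
Arguments in_boxP {m N A}.

(** * Row lengths *)

Section Rows.
Variables (C N : nat).
Implicit Types (h : {ffun 'I_C -> nat}) (c : 'I_C).
Local Open Scope nat_scope.

Definition row_len h k := #|[set c | k < h c]|.
Definition row_cap h t := \sum_(k < N.+1) minn t (row_len h k).
Definition row_fact h := \prod_(k < N.+1) (row_len h k)`!.
Definition chop c h : {ffun 'I_C -> nat} := [ffun c' => h c' - (c' == c)].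
Definition bounded h := forall c, h c <= N.+1.
Definition shortest h k c := k < h c /\ forall c', k < h c' -> h c <= h c'.

Lemma shortestP h k : 0 < row_len h k -> exists c, shortest h k c.
Proof.
case/card_gt0P=> c0; rewrite inE => hc0.
by case: (@arg_minnP _ c0 (fun c => k < h c) h hc0) => c hc minc; exists c.
Qed.

Lemma row_len_anti h k k' : k <= k' -> row_len h k' <= row_len h k.
Proof.
by move=> lek; apply/subset_leq_card/subsetP => c; rewrite !inE; apply: leq_ltn_trans.
Qed.

Lemma sum_ord_lt p k : \sum_(i < p) (i < k) = minn p k.
Proof. by elim: p => [|p IHp]; rewrite ?big_ord0 ?big_ord_recr ?IHp /=; lia. Qed.

Lemma sum_ord_eq p k : \sum_(i < p) (i == k :> nat) = (k < p).
Proof. by elim: p => [|p IHp]; rewrite ?big_ord0 ?big_ord_recr ?IHp /=; lia. Qed.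

(** Only rows longer than [t] gain when the cap grows to [t.+1], and these are among the first [k]
    rows. *)
Lemma row_capS h t k : row_len h k <= t -> row_cap h t.+1 <= row_cap h t + k.
Proof.
move=> ht; have -> : row_cap h t.+1 = row_cap h t + \sum_(i < N.+1) (t < row_len h i).
  by rewrite -big_split; apply: eq_bigr => i _ /=; lia.
rewrite leq_add2l.
apply: (@leq_trans (\sum_(i < N.+1) (i < k))).
  apply: leq_sum => i _; have := @row_len_anti h k i; lia.
by rewrite sum_ord_lt geq_minr.
Qed.

(** A column reaching row [k] is at least as high as [c], hence also reaches the last row of [c]. *)
Lemma row_len_shortest h k c : shortest h k c -> row_len h (h c).-1 = row_len h k.
Proof.
case=> hk hmin; apply: eq_card => c'; rewrite !inE.
by have := hmin c'; lia.
Qed.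

Lemma row_len_chop h k c : 0 < h c -> row_len (chop c h) k = row_len h k - (k == (h c).-1).
Proof.
move=> hc; case: eqP => [->|neq]; last first.
  rewrite subn0; apply: eq_card => c'; rewrite !inE ffunE; case: eqP => [->|] /=; lia.
rewrite subn1 /row_len (cardsD1 c [set c' | (h c).-1 < h c']) inE prednK // leqnn.
by apply: eq_card => c'; rewrite !inE ffunE; case: eqP => [->|] /=; lia.
Qed.

(** Chopping shortens by one a single row, of length [row_len h k]; the cap at [t] notices it only
    if this length is at most [t]. *)
Lemma row_cap_chop h k c t : shortest h k c ->
  row_cap h t <= row_cap (chop c h) t + (row_len h k <= t).
Proof.
move=> hc; have hc0 : 0 < h c by case: hc => + _; apply: leq_ltn_trans.
have key (i : 'I_N.+1) : minn t (row_len h i) <=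
    minn t (row_len (chop c h) i) + (row_len h k <= t) * (i == (h c).-1 :> nat).
  rewrite row_len_chop //; case: eqP => [->|_]; last by rewrite muln0; lia.
  by rewrite (row_len_shortest hc) muln1; lia.
apply: leq_trans (leq_sum _ (fun i _ => key i)) _.
rewrite big_split leq_add2l -big_distrr /= sum_ord_eq.
by rewrite -[leqRHS]muln1 leq_mul2l leq_b1 orbT.
Qed.

Lemma row_fact_chop h k c : h c <= N.+1 -> shortest h k c ->
  row_fact h = row_len h k * row_fact (chop c h).
Proof.
move=> hN hc; have hc0 : 0 < h c by case: hc => + _; apply: leq_ltn_trans.
have lt : (h c).-1 < N.+1 by lia.
rewrite /row_fact (bigD1 (Ordinal lt)) //= [in RHS](bigD1 (Ordinal lt)) //= mulnA.
congr (_ * _).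
  rewrite row_len_chop // eqxx (row_len_shortest hc) subn1.
  have : 0 < row_len h k by apply/card_gt0P; exists c; rewrite inE; case: hc.
  by case: (row_len h k) => // r _; rewrite factS.
apply: eq_bigr => i /negP ne; rewrite row_len_chop //.
by case: eqP => [e|]; rewrite ?subn0 //; case: ne; apply/eqP/val_inj.
Qed.

Lemma sum_row_len h : bounded h -> \sum_(k < N.+1) row_len h k = \sum_c h c.
Proof.
move=> hN; have len k : row_len h k = \sum_c (k < h c).
  by rewrite /row_len -sum1_card big_mkcond; apply: eq_bigr => c _; rewrite inE; case: ltnP.
rewrite (eq_bigr _ (fun (k : 'I_N.+1) _ => len k)).
rewrite exchange_big; apply: eq_bigr => c _ /=.
by rewrite sum_ord_lt; apply/minn_idPr/hN.
Qed.

Lemma bounded_chop c h : bounded h -> bounded (chop c h).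
Proof. by move=> hN c'; rewrite ffunE; have := hN c'; lia. Qed.

Lemma sum_chop c h : 0 < h c -> \sum_c' chop c h c' = (\sum_c' h c').-1.
Proof.
move=> hc; rewrite (bigD1 c) //= [in RHS](bigD1 c) //= ffunE eqxx.
have -> : \sum_(i | i != c) chop c h i = \sum_(i | i != c) h i.
  by apply: eq_bigr => c' /negbTE ne; rewrite ffunE ne subn0.
by rewrite /= addnC [in RHS]addnC; lia.
Qed.

Lemma row_fact_eq0 h : \sum_c h c = 0 -> row_fact h = 1.
Proof.
move/eqP; rewrite sum_nat_eq0 => /forallP h0; apply: big1 => k _.
suff -> : row_len h k = 0 by [].
by apply: eq_card0 => c; rewrite inE (eqP (implyP (h0 c) isT)).
Qed.

End Rows.

(** * Upper bounds on dimensions *)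

Section Annihilated.
Variables (m N C : nat).
Local Notation coeffs := (coeffs m N).
Implicit Types (h : {ffun 'I_C -> nat}) (c : 'I_C) (z : 'I_m) (X S : {set 'I_m}).
Implicit Types (F : coeffs).

(* [F] only involves the variables of [X] and satisfies Tanisaki's relations. *)
Definition annihilated h X F :=
  (forall A, ev F A != 0 -> forall s, s \notin X -> A s = 0%N) /\
  (forall S r, S \subset X ->
    (row_cap N h #|X :\: S| < r + #|X :\: S|)%N -> elsym S r F = 0).

(** The relation for [z |: S] trades a derivation in [z] for an increase of [r], up to sign. After
    all [k] derivations are traded, [row_capS] makes the relation for [S] itself applicable. *)
Lemma slice_vanish h X z k S r F :
  annihilated h X F -> z \in X -> S \subset X :\ z ->
  (row_len h k <= #|(X :\ z) :\: S|)%N ->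
  (row_cap N h #|(X :\ z) :\: S| <= r + #|(X :\ z) :\: S|)%N ->
  elsym S r (slice z k F) = 0.
Proof.
move=> [_ hF] zX /subsetD1P[SX zS] hk hr; apply: evP => A; rewrite ev0.
have [Az|Az] := eqVneq (A z) 0%N; last exact: elsym_slice0.
rewrite elsym_slice //; set t := #|_| in hk hr.
have hT : X :\: (z |: S) = (X :\ z) :\: S by apply/setP => s; rewrite !inE; case: eqP; rewrite ?andbF.
have cT : #|X :\: S| = t.+1.
  rewrite (cardsD1 z) !inE zS zX /= add1n /t; congr (_.+1).
  by apply: eq_card => s; rewrite !inE; case: eqP; rewrite ?andbF.
have step a r' : (row_cap N h t <= r' + t)%N ->
    ev (elsym S r' F) (upd z a.+1 A) = - ev (elsym S r'.+1 F) (upd z a A).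
  move=> hr'; apply/eqP; rewrite -addr_eq0 addrC.
  have := congr1 (ev^~ (upd z a A)) (hF (z |: S) r'.+1 _ _).
  rewrite hT ev0 ev_elsymS // => <-; [|by rewrite subUset sub1set zX|by rewrite addSn ltnS].
  apply/eqP; congr (_ + ev _ _); apply/ffunP => s; rewrite !ffunE !inE.
  by case: eqP; rewrite ?addn0 ?addn1.
(* Generalized for the induction: [r' + a] is invariant under the trade. *)
suff vanish a r' : (row_cap N h t.+1 <= r' + a + t)%N -> (row_cap N h t <= r' + t)%N ->
    ev (elsym S r' F) (upd z a A) = 0.
  apply: vanish => //; apply: leq_trans (row_capS N hk) _; lia.
elim: a r' => [|a IHa] r' h1 h2; last first.
  by rewrite step // IHa ?oppr0 //; lia.
by rewrite (hF S r') ?ev0 // cT; lia.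
Qed.

(** Take [S = X :\ z] and [r = 0] in [slice_vanish]: the complement is empty and [e_0] is the
    identity. *)
Lemma slice_eq0 h X z k F :
  annihilated h X F -> z \in X -> row_len h k = 0%N -> slice z k F = 0.
Proof.
move=> hF zX h0; rewrite -(elsym0 (X :\ z) (slice z k F)).
apply: slice_vanish hF _ _ _ _ => //; rewrite ?h0 //.
rewrite setDv cards0 /row_cap; under eq_bigr do rewrite min0n.
by rewrite big1_eq.
Qed.

(** Let [t] be the number of variables of [X :\ z] outside [S]. If [row_len h k <= t], the bound
    drops by at most one and [slice_vanish] has that slack. Otherwise the bound does not drop, and
    the relation for [z |: S] at the [k]-th power of [z] reduces to the one for [S], the next slice
    being zero. *)
Lemma annihilated_slice h X z k c F :
  annihilated h X F -> z \in X -> shortest h k c -> slice z k.+1 F = 0 ->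
  annihilated (chop c h) (X :\ z) (slice z k F).
Proof.
move=> hF zX hc F0; split=> [A|S r SX ht].
  rewrite ev_slice; case: (A z =P 0%N) => [Az /hF.1 As s|]; last by rewrite eqxx.
  rewrite !inE negb_and negbK => /orP[/eqP-> //|sX].
  by have := As s sX; rewrite ffunE; case: eqP => // ->.
have cap := row_cap_chop N #|(X :\ z) :\: S| hc.
case: (leqP (row_len h k) #|(X :\ z) :\: S|) => hk.
  apply: (slice_vanish hF) => //; move: cap; rewrite hk; lia.
move: cap; rewrite (leqNgt (row_len h k)) hk addn0 => cap.
have /subsetD1P[SX' zS] := SX.
have hT : X :\: (z |: S) = (X :\ z) :\: S by apply/setP => s; rewrite !inE; case: eqP; rewrite ?andbF.
have := hF.2 (z |: S) r _ _; rewrite hT => EF.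
have {}EF : elsym (z |: S) r F = 0.
  by apply: EF; [rewrite subUset sub1set zX|lia].
case: r EF ht => [|r] EF ht.
  by move: EF; rewrite !elsym0 => ->; rewrite linear0.
apply: evP => A; rewrite ev0.
have [Az|Az] := eqVneq (A z) 0%N; last exact: elsym_slice0.
rewrite elsym_slice //.
have := congr1 (ev^~ (upd z k A)) EF; rewrite ev0 ev_elsymS //.
have -> : inc [set z] (upd z k A) = upd z k.+1 A.
  by apply/ffunP => s; rewrite !ffunE !inE; case: eqP; rewrite ?addn0 ?addn1.
by rewrite -(elsym_slice k.+1 r F zS Az) F0 linear0 ev0 addr0.
Qed.

(** Induction on the number of variables. The slice at [k] of the elements of degree at most [k] in
    [z] satisfies the relations of [chop c h], which gives at most [row_len h k * n! / row_fact h];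
    the row lengths add up to [n.+1]. *)
Lemma dim_annihilated n h X (W : {vspace coeffs}) :
  #|X| = n -> (\sum_c h c)%N = n -> bounded N h ->
  (forall F, F \in W -> annihilated h X F) ->
  (\dim W * row_fact N h <= n`!)%N.
Proof.
elim: n h X W => [|n IHn] h X W cX sh hN hW.
  rewrite row_fact_eq0 // muln1 fact0.
  have X0 : X = set0 by apply/eqP; rewrite -cards_eq0 cX.
  (* Without variables only the constants remain; [F0] is the constant [1]. *)
  pose F0 : coeffs := tabulate (fun A => (A == [ffun=> 0%N])%:R).
  have evF0 A : ev F0 A = (A == [ffun=> 0%N])%:R.
    apply: ev_tabulate; case: (A =P [ffun=> 0%N]) => [-> _|]; last by rewrite eqxx.
    by apply/in_boxP => s; rewrite ffunE.
  apply: (@leq_trans (\dim <[F0]>)); last by rewrite dim_vline; case: (_ != _).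
  apply/dimvS/subvP => F /hW [hF _]; apply/vlineP; exists (ev F [ffun=> 0%N]).
  apply: evP => A; rewrite evZ evF0; case: eqP => [->|nA]; first by rewrite mulr1.
  rewrite mulr0; apply/eqP; apply/negPn/negP => /hF As.
  by case: nA; apply/ffunP => s; rewrite ffunE As // X0 inE.
have [z zX] : exists z, z \in X by apply/card_gt0P; rewrite cX.
have step (k : 'I_N.+1) :
    (\dim (linfun (slice z k) @: low_part z W k.+1) * row_fact N h <= row_len h k * n`!)%N.
  have [h0|hk0] := posnP (row_len h k).
    suff -> : (linfun (slice z k) @: low_part z W k.+1 = 0)%VS by rewrite dimv0.
    apply/eqP; rewrite -subv0; apply/subvP => _ /memv_imgP[F /mem_low_part[FW _] ->].
    by rewrite lfunE /= (slice_eq0 (hW _ FW)) ?mem0v.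
  have [c hc] := shortestP hk0.
  rewrite (row_fact_chop (hN c) hc) mulnCA leq_mul2l; apply/orP; right.
  have hc0 : (0 < h c)%N by case: hc => + _; apply: leq_ltn_trans.
  apply: IHn (X :\ z) _ _ _ _ _.
  - by move: cX; rewrite (cardsD1 z) zX => -[].
  - by rewrite sum_chop // sh.
  - exact: bounded_chop.
  move=> _ /memv_imgP[F /mem_low_part[FW Fk] ->]; rewrite lfunE /=.
  by apply: annihilated_slice (hW _ FW) _ hc _ => //; apply: Fk.
rewrite (dim_slices z) big_distrl /=; apply: leq_trans (leq_sum _ (fun k _ => step k)) _.
by rewrite -big_distrl /= sum_row_len // sh factS.
Qed.

End Annihilated.

(** * Generalized Vandermonde determinants *)

Lemma det_support (R : comNzRingType) m (M : 'M[R]_m) :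
  \det M != 0 -> exists sg : {perm 'I_m}, forall s, M s (sg s) != 0.
Proof.
move=> M0; suff /existsP[sg /forallP] : [exists sg : {perm 'I_m}, forall s, M s (sg s) != 0].
  by exists sg.
apply: contraNT M0 => /existsPn h; apply/eqP/big1 => sg _.
have /forallPn[s] := h sg; rewrite negbK => /eqP e0.
by rewrite (bigD1 s) //= e0 mul0r mulr0.
Qed.

(** Only permutations fixing [z] contribute, and these use no other entry of row or column [z] than
    the diagonal one. *)
Lemma det_delta_row (R : comNzRingType) m (M M' : 'M[R]_m) z :
  (forall t, t != z -> M z t = 0) -> (forall t, t != z -> M' z t = 0) ->
  (forall s t, (s == z) = (t == z) -> M s t = M' s t) -> \det M = \det M'.
Proof.
move=> Mz M'z eqM; apply: eq_bigr => sg _; congr (_ * _).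
have [sz|nsz] := eqVneq (sg z) z.
  apply: eq_bigr => s _; apply: eqM; rewrite -{2}sz.
  by rewrite (inj_eq perm_inj).
by rewrite (bigD1 z) //= Mz // mul0r (bigD1 z) //= M'z // mul0r.
Qed.

(* The derivative at [t = 0] of [\det (M *m (1 + t N)) = \det M * \det (1 + t N)]. *)
Lemma sum_det_replace_row (R : comNzRingType) m (M N : 'M[R]_m) :
  \sum_s \det (\matrix_(i, j) if i == s then (M *m N) i j else M i j) =
  \tr N * \det M.
Proof.
transitivity (\tr (M *m N *m \adj M)); last first.
  by rewrite mxtrace_mulC mulmxA mul_adj_mx mul_scalar_mx mxtraceZ mulrC.
apply: eq_bigr => s _; rewrite (expand_det_row _ s) [RHS]mxE; apply: eq_bigr => j _.
rewrite !mxE eqxx; congr (_ * (_ * \det _)).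
apply/matrixP => i k; rewrite !mxE eq_sym.
by rewrite (negbTE (neq_lift _ _)).
Qed.

Lemma size_prod_le (R : nzRingType) (J : finType) (F : J -> {poly R}) (k : J -> nat) :
  (forall i, size (F i) <= (k i).+1)%N ->
  (size (\prod_i F i)%R <= (\sum_i k i).+1)%N.
Proof.
move=> h; elim/big_rec2: _ => [|i p q _ IH]; first by rewrite size_poly1.
by apply: leq_trans (size_polyMleq _ _) _; have := h i; lia.
Qed.

Section Generators.
Variables (m N C : nat).
Local Notation coeffs := (coeffs m N).
Local Notation cols := 'I_C.+1.
Implicit Types (h : {ffun cols -> nat}) (c : cols) (z : 'I_m) (X S : {set 'I_m}).
Implicit Types (F : coeffs) (A : expo m).
Implicit Types (d : 'I_m -> nat * cols) (b : 'I_m -> cols).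

(** A variable outside [X] gets a diagonal row that forces its exponent to be [0], so the matrix
    keeps its size when variables are removed. *)
Definition entry X d b s a t : rat :=
  (if s \in X then (t \in X) && ((a, b s) == d t) else (a == 0%N) && (s == t))%:R.

Definition incidence X d b A := \matrix_(s, t) entry X d b s (A s) t.

(* Up to sign and normalization, the product over the columns [c] of the
   generalized Vandermonde determinants in the variables [s] with [b s = c],
   whose exponents are the rows of the cells of [d] in column [c]. *)
Definition generator X d b : coeffs :=
  tabulate (fun A => \det (incidence X d b A)).

(** A bijection from [X] to the cells of the diagram with column heights [h]; it names the columns
    of [incidence]. *)
Definition labelling h X d :=
  [/\ {in X &, injective d},
      forall s, s \in X -> ((d s).1 < h (d s).2)%N &
      forall c r, (r < h c)%N -> exists2 s, s \in X & d s = (r, c)].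

Lemma det_incidence_neq0 X d b A : \det (incidence X d b A) != 0 ->
  exists sg : {perm 'I_m}, forall s,
    if s \in X then sg s \in X /\ d (sg s) = (A s, b s) else A s = 0%N.
Proof.
case/det_support=> sg hsg; exists sg => s; have := hsg s; rewrite mxE /entry.
by case: ifP => _; rewrite pnatr_eq0 eqb0 negbK => /andP[h1 /eqP h2] //; apply/eqP.
Qed.

Lemma ev_generator h X d b A : bounded N h -> labelling h X d ->
  ev (generator X d b) A = \det (incidence X d b A).
Proof.
move=> hN [_ dh _]; apply: ev_tabulate => /det_incidence_neq0[sg hsg].
apply/in_boxP => s; have := hsg s; case: ifP => [_ [sX e]|_ ->] //.
by have := dh _ sX; rewrite e /= => /leq_trans/(_ (hN _)).
Qed.

Lemma eq_generator X d d' b b' : {in X, d =1 d'} -> {in X, b =1 b'} ->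
  generator X d b = generator X d' b'.
Proof.
move=> ed eb; apply: evP => A; rewrite /ev; case: ifP => // _; rewrite !ffunE.
congr (\det _); apply/matrixP => s t; rewrite !mxE /entry; case: ifP => // sX.
by rewrite eb //; case: (boolP (t \in X)) => //= tX; rewrite ed.
Qed.

(** At exponent [k] the row of [z] has its only nonzero entry on the diagonal, just as when [z] is
    removed from [X]. *)
Lemma slice_generator h X d b z k : bounded N h -> labelling h X d ->
  z \in X -> d z = (k, b z) ->
  slice z k (generator X d b) = generator (X :\ z) d b.
Proof.
move=> hN dX zX dz; apply: evP => A; rewrite ev_slice (ev_generator _ _ hN dX).
have [dinj dh _] := dX.
have -> : ev (generator (X :\ z) d b) A = \det (incidence (X :\ z) d b A).
  apply: ev_tabulate => /det_incidence_neq0[sg hsg].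
  apply/in_boxP => s; have := hsg s; case: ifP => [_ [sX e]|_ ->] //.
  have /setD1P[_ /dh] := sX; by rewrite e /= => /leq_trans/(_ (hN _)).
case: (A z =P 0%N) => [Az|nAz]; last first.
  apply/esym/eqP/negPn/negP => /det_incidence_neq0[sg /(_ z)].
  by rewrite !inE eqxx.
have row_z t : (t \in X) && ((k, b z) == d t) = (t == z).
  rewrite -dz; apply/andP/eqP => [[tX /eqP e]|->]; last by [].
  by apply/esym/dinj.
apply: (@det_delta_row _ _ _ _ z) => [t tz|t tz|s t est]; rewrite !mxE /entry.
- by rewrite ffunE eqxx zX row_z (negbTE tz).
- by rewrite !inE eqxx /= (eq_sym z) (negbTE tz) andbF.
rewrite !ffunE !inE -est; case: (eqVneq s z) est => [-> /esym/eqP->|sz /esym tz] /=.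
  by rewrite eqxx zX dz Az !eqxx.
by [].
Qed.

Lemma slice_generator_eq0 h X d b z k : bounded N h -> labelling h X d ->
  z \in X -> (h (b z) <= k)%N -> slice z k (generator X d b) = 0.
Proof.
move=> hN dX zX hk; apply: evP => A; rewrite ev_slice (ev_generator _ _ hN dX) ev0.
case: ifP => // _; apply/eqP/negPn/negP => /det_incidence_neq0[sg /(_ z)].
rewrite zX ffunE eqxx => -[sX e]; have [_ /(_ _ sX) + _] := dX.
by rewrite e /= ltnNge hk.
Qed.

End Generators.

(** * Tanisaki's relations for products of Vandermonde determinants *)

Section Annihilation.
Variables (m N C : nat) (h : {ffun 'I_C.+1 -> nat}).
Variables (X : {set 'I_m}) (d : 'I_m -> nat * 'I_C.+1) (b : 'I_m -> 'I_C.+1).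
Hypotheses (hN : bounded N h) (hd : labelling h X d).
Implicit Types (S : {set 'I_m}) (A : expo m).

(** Count by rows: row [k] meets the columns of [H] in at most [minn t (row_len h k)] cells. *)
Lemma card_cells_cols (H : {set 'I_C.+1}) t : (#|H| <= t)%N ->
  (#|[set u in X | (d u).2 \in H]| <= row_cap N h t)%N.
Proof.
have [dinj dh _] := hd; move=> Ht.
rewrite -sum1_card (partition_big (fun u => inord (d u).1 : 'I_N.+1) xpredT) //=.
apply: leq_sum => k _; rewrite sum1dep_card.
have inX u : u \in [set u0 | (u0 \in [set u1 in X | (d u1).2 \in H]) &
                       (inord (d u0).1 : 'I_N.+1) == k] ->
    [/\ u \in X, (d u).2 \in H & (d u).1 = k].
  rewrite !inE => /andP[/andP[uX uH] /eqP uk]; split=> //.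
  by rewrite -uk inordK // (leq_trans (dh _ uX)).
have inj2 : {in [set u0 | (u0 \in [set u1 in X | (d u1).2 \in H]) &
                       (inord (d u0).1 : 'I_N.+1) == k] &, injective (fun u => (d u).2)}.
  move=> u v /inX[uX _ u1] /inX[vX _ v1] e; apply: dinj => //.
  by rewrite (surjective_pairing (d u)) u1 e -v1 -surjective_pairing.
rewrite leq_min -(card_in_imset inj2); apply/andP; split.
  apply: leq_trans Ht; apply/subset_leq_card/subsetP => _ /imsetP[u /inX[_ uH _] ->].
  by [].
apply/subset_leq_card/subsetP => _ /imsetP[u /inX[uX _ uk] ->].
by rewrite inE -uk dh.
Qed.

Section Column_operation.
Variables (S : {set 'I_m}) (A : expo m).
Hypothesis SX : S \subset X.

(* The rows of [e_S(t)] applied to the generator at [A], where [e_S(t)] is the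
   product over [s] in [S] of [1 + t d/dx_s]. *)
Definition shifted_incidence : 'M[{poly rat}]_m :=
  \matrix_(s, t) ((if s \in S then (entry X d b s (A s).+1 t)%:P * 'X else 0) +
                  (entry X d b s (A s) t)%:P).

Lemma det_shifted_incidence :
  \det shifted_incidence =
  \sum_(T : {set 'I_m} | T \subset S) (\det (incidence X d b (inc T A)))%:P * 'X^#|T|.
Proof.
rewrite /determinant.
transitivity (\sum_(sg : 'S_m) \sum_(T : {set 'I_m} | T \subset S)
   ((-1) ^+ sg * \prod_s incidence X d b (inc T A) s (sg s))%:P * 'X^#|T|); last first.
  by rewrite exchange_big; apply: eq_bigr => T _ /=; rewrite rmorph_sum mulr_suml.
apply: eq_bigr => sg _; under eq_bigr do rewrite mxE.
rewrite bigA_distr mulr_sumr (bigID (fun T : {set 'I_m} => T \subset S)) /=.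
rewrite [X in _ + X]big1 ?addr0 => [|T /subsetPn[s sT sS]]; last first.
  by rewrite (bigD1 s) //= sT (negbTE sS) mul0r mulr0.
apply: eq_bigr => T /subsetP TS; rewrite rmorphM rmorphXn rmorphN1 -mulrA; congr (_ * _).
transitivity (\prod_s ((incidence X d b (inc T A) s (sg s))%:P * 'X^(s \in T))).
  apply: eq_bigr => s _; rewrite mxE ffunE; case: ifP => sT.
    by rewrite (TS _ sT) addn1 expr1.
  by rewrite addn0 expr0 mulr1.
rewrite big_split /= rmorph_prod; congr (_ * _).
rewrite -sum1_card; under [in RHS]eq_bigl do rewrite /=.
by rewrite [in RHS]big_mkcond /= prodrXr; congr (_ ^+ _); apply: eq_bigr => s _; case: ifP.
Qed.

(** The columns holding a variable outside [S]; in the other columns, all variables are in [S]. *)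
Let H := [set b s | s in X :\: S].

Definition col_shift u v : bool :=
  [&& u \in X, v \in X, (d u).2 \notin H & d v == ((d u).1.+1, (d u).2)].

(** For the columns of the diagram outside [H], this adds ['X] times the matrix column of each cell
    to that of the cell in the next row. *)
Definition col_op : 'M[{poly rat}]_m := \matrix_(u, v) ((u == v)%:R + (col_shift u v)%:R * 'X).

(** A permutation contributing to the determinant raises by one the row of each point that it moves,
    yet preserves the sum of the rows; so it is the identity. *)
Lemma det_col_op : \det col_op = 1.
Proof.
rewrite /determinant (bigD1 1%g) //= odd_perm1 expr0 mul1r [X in X + _]big1 => [|s _]; last first.
  rewrite mxE perm1 eqxx /col_shift; case: eqP => [/(congr1 fst)/= e|_].
    by move: (n_Sn (d s).1); rewrite -e.
  by rewrite !andbF mul0r addr0.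
rewrite big1 ?addr0 // => sg nsg; suff -> : \prod_s col_op s (sg s) = 0 by rewrite mulr0.
apply/eqP/prodf_eq0; suff /existsP[s hs] : [exists s, col_op s (sg s) == 0] by exists s.
apply: contraR nsg => /existsPn /= h0.
have mono s : sg s != s -> (d (sg s)).1 = (d s).1.+1.
  move=> ne; have := h0 s; rewrite mxE (eq_sym s) (negbTE ne) add0r.
  case: (boolP (col_shift _ _)) => [/and4P[_ _ _ /eqP-> //]|_]; by rewrite mul0r eqxx.
apply/eqP/permP => s; rewrite perm1; apply/eqP; apply: contraT => ne.
have : (\sum_u (d (sg u)).1 = \sum_u (d u).1)%N.
  by rewrite [RHS](reindex_inj (@perm_inj _ sg)).
rewrite (bigD1 s) //= [in RHS](bigD1 s) //= mono // => e.
have : (\sum_(i < m | i != s) (d i).1 <= \sum_(i < m | i != s) (d (sg i)).1)%N.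
  by apply: leq_sum => i _; have [->|/mono->] := eqVneq (sg i) i.
by rewrite -(leq_add2l (d s).1) -e addSn ltnn.
Qed.

Definition reduced_incidence : 'M[{poly rat}]_m :=
  \matrix_(s, t) if (s \in S) && (b s \notin H) then (entry X d b s (A s) t)%:P
                 else shifted_incidence s t.

(** If [b s] is outside [H], then [1 + t d/dx_s] acts on row [s] exactly as the column operation
    does. All other rows vanish at the cells that [col_op] moves. *)
Lemma reduced_incidenceE : shifted_incidence = reduced_incidence *m col_op.
Proof.
have [dinj dh dsurj] := hd.
apply/matrixP => s v; rewrite [RHS]mxE.
under [RHS]eq_bigr => u _.
  rewrite [col_op _ _]mxE mulrDr mulrA; over.
rewrite big_split /= (bigD1 v) //= eqxx mulr1 big1 ?addr0 => [|u /negbTE->]; last first.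
  by rewrite mulr0.
rewrite -mulr_suml.
have [/andP[sS bsH]|nsb] := boolP ((s \in S) && (b s \notin H)).
  have sX := subsetP SX _ sS.
  rewrite [reduced_incidence s v]mxE mxE sS bsH /= [RHS]addrC; congr (_ * _ + _).
  transitivity (\sum_u (entry X d b s (A s) u * (col_shift u v)%:R)%:P); last first.
    by apply: eq_bigr => u _; rewrite mxE sS bsH rmorphM; congr (_ * _); rewrite /= rmorph_nat.
  rewrite -rmorph_sum; congr (_%:P); rewrite /entry sX.
  have [ev|nev] := boolP ((v \in X) && (((A s).+1, b s) == d v)).
    have /andP[vX /eqP dv] := ev.
    have [|u0 u0X du0] := dsurj (b s) (A s).
      by have := dh v vX; rewrite -dv /=; apply: ltn_trans.
    rewrite (bigD1 u0) //= u0X du0 eqxx /col_shift u0X vX du0 /= -dv eqxx bsH.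
    rewrite mulr1 big1 ?addr0 // => u ne; case: (boolP (_ && _)) => [/andP[uX /eqP e]|_].
      by case/eqP: ne; apply: dinj; rewrite // -e.
    by rewrite mul0r.
  rewrite big1 // => u _; case: (boolP (_ && _)) => [/andP[uX /eqP e]|_]; last by rewrite mul0r.
  suff -> : col_shift u v = false by rewrite mulr0.
  by apply: contraNF nev; rewrite /col_shift -e => /and4P[_ -> _ /eqP->]; rewrite eqxx.
rewrite [in X in _ = X + _]mxE (negbTE nsb) big1 ?mul0r ?addr0 // => u _.
rewrite mxE (negbTE nsb) mxE /entry; case: (boolP (col_shift u v)); last by rewrite mulr0.
case/and4P=> uX vX uH _; rewrite mulr1.
have [sX|sX] := boolP (s \in X); last first.
  have /negbTE-> : s \notin S by apply: contra sX; apply: (subsetP SX).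
  by rewrite [s == u](_ : _ = false) ?andbF ?addr0 //; apply: contraNF sX => /eqP->.
have bsH : b s \in H.
  by move: nsb; rewrite negb_and negbK => /orP[sS|//]; apply: imset_f; rewrite inE sS.
have nd a : ((a, b s) == d u) = false by apply: contraNF uH => /eqP<-.
by rewrite !nd !andbF mul0r if_same addr0.
Qed.

(** Only rows [s] in [S] with [b s] in [H] still involve ['X]. If the determinant has a nonzero
    term, the variables sent to [H] are matched with cells of [H], so there are at most
    [row_cap N h #|X :\: S|] of them, and [#|X :\: S|] of these lie outside [S]. *)
Lemma size_det_reduced r : (row_cap N h #|X :\: S| < r + #|X :\: S|)%N ->
  (\det reduced_incidence)`_r = 0.
Proof.
move=> hr; rewrite coef_sum big1 // => sg _.
have -> : (-1) ^+ sg = ((-1) ^+ sg)%:P :> {poly rat} by rewrite rmorphXn rmorphN1.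
rewrite coefCM; suff -> : (\prod_s reduced_incidence s (sg s))`_r = 0.
  by rewrite mulr0.
have [->|] := eqVneq (\prod_s reduced_incidence s (sg s)) 0; first by rewrite coef0.
move/prodf_neq0 => /= hsg.
have sgX s : s \in X -> sg s \in X /\ (d (sg s)).2 = b s.
  move=> sX; have := hsg s isT; rewrite !mxE /entry sX.
  case: (boolP (sg s \in X)) => /= [sgX|_]; last by rewrite mul0r if_same addr0 if_same eqxx.
  case: (eqVneq (d (sg s)).2 (b s)) => [->|ne]; first by [].
  have nd a : ((a, b s) == d (sg s)) = false by apply: contraNF ne => /eqP<-.
  by rewrite !nd mul0r if_same addr0 if_same eqxx.
apply: nth_default; apply: leq_trans (size_prod_le (k := fun s => (s \in S) && (b s \in H)) _) _.
  move=> s; rewrite mxE; case: (boolP (s \in S)) => sS /=; last first.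
    by rewrite mxE (negbTE sS) add0r size_polyC leq_b1.
  case: (boolP (b s \in H)) => /= _; last by rewrite size_polyC leq_b1.
  rewrite mxE sS; apply: leq_trans (size_polyD _ _) _; rewrite geq_max.
  apply/andP; split; last by rewrite size_polyC; case: (_ != _).
  by apply: leq_trans (size_polyMleq _ _) _; rewrite size_polyX size_polyC; case: (_ != _).
have cardH : (#|H| <= #|X :\: S|)%N by apply: leq_imset_card.
have leH : (#|[set s in X | b s \in H]| <= row_cap N h #|X :\: S|)%N.
  apply: leq_trans (card_cells_cols cardH).
  rewrite -(card_imset _ (@perm_inj _ sg)); apply/subset_leq_card/subsetP => _ /imsetP[s + ->].
  by rewrite !inE => /andP[/sgX[-> ->] ->].
suff eS : (\sum_s ((s \in S) && (b s \in H)) + #|X :\: S| = #|[set s in X | b s \in H]|)%N.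
  by move: hr leH; rewrite -eS; lia.
rewrite -(cardsID S [set s in X | b s \in H]); congr (_ + _)%N.
  rewrite -sum1_card [RHS]big_mkcond; apply: eq_bigr => s _ /=; rewrite !inE.
  by case: (boolP (s \in S)) => [/(subsetP SX)->|_]; rewrite ?andbF //; case: (_ \in H).
apply: eq_card => s; rewrite !inE; case: (boolP (s \in S)) => //= sS.
by case: (boolP (s \in X)) => //= sX; apply/esym/imset_f; rewrite inE sS.
Qed.

End Column_operation.

(** The value of [e_r] is the coefficient of ['X^r] in [\det (shifted_incidence S A)], which equals
    [\det (reduced_incidence S A)]. *)
Lemma annihilated_generator : annihilated h X (generator N X d b).
Proof.
split=> [A|S r SX hr].
  rewrite (ev_generator _ _ hN hd) => /det_incidence_neq0[sg hsg] s sX.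
  by have := hsg s; rewrite (negbTE sX).
apply: evP => A; rewrite ev0 ev_elsym.
under eq_bigr do rewrite (ev_generator _ _ hN hd).
transitivity ((\det (reduced_incidence S A))`_r); last exact: size_det_reduced.
rewrite -[\det (reduced_incidence _ _)]mulr1 -(det_col_op S) -det_mulmx.
rewrite -reduced_incidenceE // det_shifted_incidence // coef_sum big_mkcondr /=.
apply: eq_bigr => T _; rewrite coefCM coefXn eq_sym.
by case: eqP; rewrite ?mulr1 ?mulr0.
Qed.

End Annihilation.

(** * Lower bounds on dimensions *)

Section Generated.
Variables (m N C : nat).
Local Notation coeffs := (coeffs m N).
Local Notation cols := 'I_C.+1.
Implicit Types (h : {ffun cols -> nat}) (c : cols) (z : 'I_m) (X S : {set 'I_m}).
Implicit Types (F : coeffs) (A e : expo m) (W : {vspace coeffs}).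
Implicit Types (d : 'I_m -> nat * cols) (b : 'I_m -> cols).

Definition supported X e := forall s, s \notin X -> e s = 0%N.

(** [W] contains V(h); only this inclusion enters the lower bound, and slices inherit it. *)
Definition generated h X W :=
  (forall d b, labelling h X d -> generator N X d b \in W) /\
  (forall e F, supported X e -> F \in W -> shift e F \in W).

Lemma labelling_extend h X d z c : z \in X -> (0 < h c)%N ->
  labelling (chop c h) (X :\ z) d ->
  labelling h X (fun s => if s == z then ((h c).-1, c) else d s).
Proof.
move=> zX hc [dinj dh dsurj].
have dX s : s \in X -> s != z -> s \in X :\ z by rewrite !inE => -> ->.
have dz s : s \in X -> s != z -> ((h c).-1, c) <> d s.
  move=> sX sz e; have := dh s (dX s sX sz); rewrite -e ffunE eqxx /=; lia.
split=> [s t sX tX|s sX|c' r hr].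
- case: (eqVneq s z) (eqVneq t z) => [->|sz] [->|tz] // e.
  + by case: (dz t).
  + by case: (dz s).
  + by apply: dinj e; apply: dX.
- case: eqVneq => [_|sz] /=; first by rewrite prednK.
  by have := dh s (dX s sX sz); rewrite ffunE => /leq_trans; apply; apply: leq_subr.
have [e|ne] := eqVneq (r, c') ((h c).-1, c).
  by exists z; rewrite // eqxx e.
have [|s /setD1P[sz sX] ds] := dsurj c' r.
  rewrite ffunE; have [ec|_] := eqVneq c' c; last by rewrite subn0.
  by move: ne; rewrite ec xpair_eqE eqxx andbT in hr *; move: hr; rewrite subn1; lia.
by exists s; rewrite // (negbTE sz).
Qed.

Lemma generator_slice h X d b z c : bounded N h -> z \in X -> (0 < h c)%N ->
  labelling (chop c h) (X :\ z) d ->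
  let d' := fun s => if s == z then ((h c).-1, c) else d s in
  let b' := fun s => if s == z then c else b s in
  generator N (X :\ z) d b = slice z (h c).-1 (generator N X d' b').
Proof.
move=> hN zX hc hd /=.
have hd' := labelling_extend zX hc hd.
rewrite (slice_generator hN hd') ?eqxx //.
by apply: eq_generator => s /setD1P[/negbTE-> _].
Qed.

Lemma slice_shift_var z k p F :
  slice z k (shift (upd z p [ffun=> 0%N]) F) = slice z (k + p) F.
Proof.
apply: evP => A; rewrite !(ev_slice, ev_shift); case: ifP => // _.
by congr ev; apply/ffunP => s; rewrite !ffunE; case: eqP; rewrite ?addn0.
Qed.

Lemma supported_var X z p : z \in X -> supported X (upd z p [ffun=> 0%N]).
Proof. by move=> zX s sX; rewrite !ffunE; case: eqP => // sz; rewrite sz zX in sX. Qed.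

Lemma generated_slice h X z k c W : bounded N h -> z \in X -> shortest h k c ->
  generated h X W ->
  generated (chop c h) (X :\ z) (linfun (slice z k) @: low_part z W k.+1)%VS.
Proof.
move=> hN zX hc [genW shW]; have hk : (k < h c)%N by case: hc.
have hc0 : (0 < h c)%N by apply: leq_ltn_trans hk.
split=> [d b hd|e _ he /memv_imgP[F /mem_low_part[FW F0] ->]].
  pose d' s := if s == z then ((h c).-1, c) else d s.
  pose b' s := if s == z then c else b s.
  have hd' : labelling h X d' := labelling_extend zX hc0 hd.
  (* With [z] in column [c] the degree in [z] is at most [(h c).-1]; these derivations in [z] bring
     it down to at most [k]. *)
  pose F := shift (upd z ((h c).-1 - k) [ffun=> 0%N]) (generator N X d' b').
  apply/memv_imgP; exists F.
    apply/mem_low_part; split; first by apply: shW; [apply: supported_var|apply: genW].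
    move=> a lta; rewrite slice_shift_var (slice_generator_eq0 _ hd') //.
    by rewrite /b' eqxx; lia.
  rewrite lfunE /= slice_shift_var (generator_slice b hN zX hc0 hd).
  by congr (slice _ _ _); lia.
have ez : e z = 0%N by apply: he; rewrite !inE eqxx.
apply/memv_imgP; exists (shift e F); last by rewrite !lfunE /= shift_slice.
apply/mem_low_part; split.
  by apply: shW => // s sX; apply: he; rewrite inE negb_and sX orbT.
by move=> a lta; rewrite -shift_slice // F0 // linear0.
Qed.

(** The induction of [dim_annihilated] with the inequalities reversed; without variables, [W]
    contains a nonzero constant. *)
Lemma dim_generated n h X W :
  #|X| = n -> (\sum_c h c)%N = n -> bounded N h -> generated h X W ->
  (n`! <= \dim W * row_fact N h)%N.
Proof.
elim: n h X W => [|n IHn] h X W cX sh hN genW.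
  rewrite row_fact_eq0 // muln1 fact0.
  have X0 : X = set0 by apply/eqP; rewrite -cards_eq0 cX.
  have h0 c : h c = 0%N.
    by move/eqP: sh; rewrite sum_nat_eq0 => /forallP/(_ c)/implyP/(_ isT)/eqP.
  pose d (s : 'I_m) : nat * cols := (0%N, ord0).
  have hd : labelling h X d by split=> [s t|s|c r]; rewrite ?X0 ?inE ?h0.
  have GW := genW.1 d (fun=> ord0) hd.
  have : (\dim <[generator N X d (fun=> ord0)]> <= \dim W)%N.
    by apply: dimvS; rewrite -memvE.
  apply: leq_trans; rewrite dim_vline lt0b.
  apply/eqP => /(congr1 (ev^~ [ffun=> 0%N])); rewrite (ev_generator _ _ hN hd) ev0.
  suff -> : incidence X d (fun=> ord0) [ffun=> 0%N] = 1%:M.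
    by rewrite det1 => /eqP; rewrite oner_eq0.
  by apply/matrixP => s t; rewrite !mxE /entry X0 inE ffunE.
have [z zX] : exists z, z \in X by apply/card_gt0P; rewrite cX.
have step (k : 'I_N.+1) : (row_len h k * n`! <=
    \dim (linfun (slice z k) @: low_part z W k.+1) * row_fact N h)%N.
  have [->//|hk0] := posnP (row_len h k).
  have [c hc] := shortestP hk0.
  have hc0 : (0 < h c)%N by case: hc => + _; apply: leq_ltn_trans.
  rewrite (row_fact_chop (hN c) hc) mulnCA leq_mul2l; apply/orP; right.
  apply: (IHn _ (X :\ z)); last exact: generated_slice.
  - by move: cX; rewrite (cardsD1 z) zX => -[].
  - by rewrite sum_chop // sh.
  exact: bounded_chop.
rewrite (dim_slices z W) big_distrl /=; apply: leq_trans (leq_sum _ (fun k _ => step k)).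
by rewrite -big_distrl /= sum_row_len // sh factS.
Qed.

End Generated.

(** * Punctured diagrams *)

Section Punctured.
Variables (m N C : nat) (h : {ffun 'I_C.+1 -> nat}) (z : 'I_m).
Variables (d : 'I_m -> nat * 'I_C.+1) (j : 'I_C.+1).
Hypotheses (hN : bounded N h) (hd : labelling h setT d) (sumh : (\sum_c h c)%N = m).
Local Notation coeffs := (coeffs m N).
Local Notation cols := 'I_C.+1.
Implicit Types (F : coeffs) (A e : expo m) (b : 'I_m -> cols) (c : cols).

(** A Garnir relation: [sum_det_replace_row] for the assignment [b0] and a matrix of trace zero.
    Each term moves one variable from column [j] to column [c], and the term of [z] is the left-hand
    side. *)
Lemma generator_exchange b c : b z = c -> c != j -> (h c <= h j)%N ->
  let b0 := fun s => if s == z then j else b s in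
  generator N setT d b =
  - \sum_(a | (a != z) && (b a == j)) generator N setT d (fun s => if s == a then c else b0 s).
Proof.
move=> bz cj hcj b0; have [dinj dh dsurj] := hd.
apply: evP => A; rewrite evN ev_sum (ev_generator _ _ hN hd).
under eq_bigr do rewrite (ev_generator _ _ hN hd).
pose shiftN : 'M[rat]_m := \matrix_(u, v) (((d u).2 == j) && (d v == ((d u).1, c)))%:R.
have tr0 : \tr shiftN = 0.
  apply: big1 => u _; rewrite mxE; case: eqP => //= uj.
  case: eqP => // /(congr1 snd) /= uc; by move: cj; rewrite -uc uj eqxx.
have rowN s v : (incidence setT d b0 A *m shiftN) s v =
    ((b0 s == j) && (d v == (A s, c)))%:R.
  rewrite mxE.
  have [dv|dv] := eqVneq (d v) (A s, c); last first.
    rewrite andbF big1 // => u _; rewrite !mxE /entry !inE /=.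
    case: eqP => [e|_]; last by rewrite mul0r.
    by rewrite -e /= (negbTE dv) andbF mulr0.
  have [bs|bs] := eqVneq (b0 s) j; last first.
    rewrite big1 // => u _; rewrite !mxE /entry !inE /=.
    case: eqP => [e|_]; last by rewrite mul0r.
    by rewrite -e /= (negbTE bs) mulr0.
  (* Column [j] is at least as high as [c], so the cell [(A s, c)] has a counterpart in column
     [j]. *)
  have [|u _ du] := dsurj j (A s).
    by apply: leq_trans hcj; have := dh v; rewrite inE dv => /(_ isT).
  rewrite (bigD1 u) //= !mxE /entry !inE /= du bs dv !eqxx mulr1 big1 ?addr0 // => t tu.
  rewrite !mxE /entry !inE /= bs; case: eqP => [e|_]; last by rewrite mul0r.
  by case/eqP: tu; apply: dinj; rewrite // -e.
have := sum_det_replace_row (incidence setT d b0 A) shiftN; rewrite tr0 mul0r.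
have det_row s : \det (\matrix_(i, k) if i == s then (incidence setT d b0 A *m shiftN) i k
     else incidence setT d b0 A i k) =
   if b0 s == j then \det (incidence setT d (fun i => if i == s then c else b0 i) A) else 0.
  case: ifP => bs.
    congr (\det _); apply/matrixP => i k; rewrite [LHS]mxE [RHS]mxE.
    case: eqP => [->|/eqP/negbTE ne]; last by rewrite mxE /entry ne.
    by rewrite rowN bs /entry !inE eqxx /= eq_sym.
  rewrite (expand_det_row _ s) big1 // => k _; rewrite mxE eqxx rowN bs.
  by rewrite mul0r.
rewrite (eq_bigr _ (fun s _ => det_row s)) (bigD1 z) //= {1}/b0 eqxx eqxx => /eqP.
rewrite addr_eq0 => /eqP eD; rewrite (_ : \det (incidence setT d b A) = - \sum_(s | s != z)
   (if b0 s == j then \det (incidence setT d (fun i => if i == s then c else b0 i) A) else 0)).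
  congr (- _); rewrite -big_mkcondr; apply: eq_bigl => s.
  by rewrite /b0; case: eqVneq.
rewrite -eD; congr (\det _); apply/matrixP => i k; rewrite !mxE /entry /b0.
by case: (i =P z) => // ->; rewrite bz.
Qed.

Local Notation index := ({ffun 'I_m -> 'I_N.+1} * {ffun 'I_m -> cols})%type.

Definition source (u : index) : coeffs :=
  shift [ffun s => u.1 s : nat] (generator N setT d u.2).

(** No derivation in [z] is taken, since [z] stands for the removed cell. Finitely many exponents
    suffice because shifts beyond [N] vanish. *)
Definition sources : {vspace coeffs} :=
  <<[seq source u | u : index <- enum predT & (u.1 z == ord0) && (u.2 z == j)]>>%VS.

(* Slicing the generators with [b z = j] at [z = k] punctures column [j] at row [k]. *)
Definition punctured k : {vspace coeffs} := (linfun (slice z k) @: sources)%VS.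

Lemma shift_overflow e F s : (N < e s)%N -> shift e F = 0.
Proof.
move=> lt; apply: evP => A; rewrite ev_shift ev0; apply/eqP; apply: contraTT lt.
by move/ev_neq0/in_boxP/(_ s); rewrite ffunE -leqNgt; apply/leq_trans/leq_addl.
Qed.

Lemma mem_source e b : e z = 0%N -> b z = j -> shift e (generator N setT d b) \in sources.
Proof.
move=> ez bz; have [/forallP be|] := boolP [forall s, e s <= N]%N; last first.
  by rewrite negb_forall => /existsP[s]; rewrite -ltnNge => /shift_overflow->; apply: mem0v.
apply/memv_span/mapP; exists ([ffun s => inord (e s)], [ffun s => b s]) => /=.
  by rewrite mem_filter /= !ffunE ez bz eqxx andbT mem_enum andbT -val_eqE /= inordK.
rewrite /source; congr shift; first by apply/ffunP => s; rewrite !ffunE inordK // ltnS.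
by apply: eq_generator => s _; rewrite ?ffunE.
Qed.

Lemma span_ind (K : fieldType) (vT : vectType K) (P : vT -> Prop) (s : seq vT) :
  P 0 -> (forall a u v, P u -> P v -> P (a *: u + v)) -> {in s, forall v, P v} ->
  {in <<s>>%VS, forall v, P v}.
Proof.
move=> P0 PD Ps v /(@coord_span _ _ _ (in_tuple s)) ->.
elim/big_rec: _ => // i u _; apply: PD; apply/Ps/mem_nth; exact: ltn_ord.
Qed.

Lemma sources_ind (P : coeffs -> Prop) :
  P 0 -> (forall a F G, P F -> P G -> P (a *: F + G)) ->
  (forall e b, e z = 0%N -> b z = j -> P (shift e (generator N setT d b))) ->
  {in sources, forall F, P F}.
Proof.
move=> P0 PD PG; apply: span_ind => // F /mapP[u]; rewrite mem_filter => /andP[/andP[/eqP u1 /eqP u2] _] ->.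
by apply: PG => //; rewrite ffunE u1.
Qed.

Lemma shift_sources e F : e z = 0%N -> F \in sources -> shift e F \in sources.
Proof.
move=> ez; move: F; apply: sources_ind => [|a F G FW GW|e' b e'z bz].
- by rewrite linear0 mem0v.
- by rewrite linearP memvD ?memvZ.
by rewrite shift_shift; apply: mem_source; rewrite // ffunE ez e'z.
Qed.

Lemma annihilated_lin X a F G :
  annihilated h X F -> annihilated h X G -> annihilated h X (a *: F + G).
Proof.
move=> [F1 F2] [G1 G2]; split=> [A|S r SX hr]; last by rewrite linearP /= F2 // G2 // scaler0 addr0.
rewrite evD evZ => nz s sX; have [F0|/F1] := eqVneq (ev F A) 0; last exact.
by apply: G1 => //; move: nz; rewrite F0 mulr0 add0r.
Qed.

Lemma shift_comm e e' F : shift e (shift e' F) = shift e' (shift e F).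
Proof. by rewrite !shift_shift; congr shift; apply/ffunP => s; rewrite !ffunE addnC. Qed.

Lemma annihilated_sources F : F \in sources -> annihilated h setT F.
Proof.
move: F; apply: sources_ind => [|a F G|e b _ _]; last 1 first.
- have [_ aG] := annihilated_generator b hN hd.
  split=> [A _ s|S r SX hr]; first by rewrite inE.
  by rewrite elsym_shift; under eq_bigr do rewrite shift_comm; rewrite -linear_sum -elsym_shift aG ?linear0.
- split=> [A|S r _ _]; by rewrite ?ev0 ?eqxx ?linear0.
exact: annihilated_lin.
Qed.

Local Notation X' := ([set: 'I_m] :\ z).

(** Extract the [k]-th power of [z] from the relation [e_1 = 0] over all the variables, in which [z]
    contributes the next slice. *)
Lemma elsym_slice_sources k F : F \in sources ->
  elsym X' 1 (slice z k F) = - slice z k.+1 F.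
Proof.
move/annihilated_sources=> [_ hF]; apply: evP => A; rewrite evN ev_slice.
have zX : z \notin X' by rewrite !inE eqxx.
case: (A z =P 0%N) => [Az|/eqP Az]; last by rewrite oppr0 elsym_slice0.
rewrite elsym_slice //; apply/eqP; rewrite -addr_eq0; apply/eqP.
have EF : elsym setT 1 F = 0.
  by apply: hF; rewrite // setDv cards0 /row_cap big1 // => r _; rewrite min0n.
have := congr1 (ev^~ (upd z k A)) EF; rewrite ev0 -{1}(setD1K (in_setT z)) ev_elsymS //.
rewrite elsym0 => <-; congr (_ + ev _ _); apply/ffunP => s; rewrite !ffunE !inE.
by case: eqP; rewrite ?addn0 ?addn1.
Qed.

Lemma puncturedS k : punctured k.+1 = (linfun (elsym X' 1) @: punctured k)%VS.
Proof.
apply/eqP; rewrite eqEsubv; apply/andP; split; apply/subvP => G.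
  case/memv_imgP=> F FW ->; apply/memv_imgP; exists (slice z k (- F)).
    by apply/memv_imgP; exists (- F); rewrite ?memvN ?lfunE.
  by rewrite !lfunE /= elsym_slice_sources ?memvN // linearN opprK.
case/memv_imgP=> _ /memv_imgP[F FW ->] ->; apply/memv_imgP; exists (- F).
  by rewrite memvN.
by rewrite !lfunE /= elsym_slice_sources // linearN.
Qed.

Lemma shift_punctured k e F : e z = 0%N -> F \in punctured k -> shift e F \in punctured k.
Proof.
move=> ez /memv_imgP[G GW ->]; rewrite lfunE /= shift_slice //.
by apply/memv_imgP; exists (shift e G); rewrite ?shift_sources ?lfunE.
Qed.

(** Each step applies [e_1], a sum of derivations in variables other than [z], and these preserve
    [punctured k]. *)
Lemma punctured_anti k k' : (k <= k')%N -> (punctured k' <= punctured k)%VS.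
Proof.
move/subnK<-; elim: (_ - _)%N => [|p IHp]; first exact: subvv.
apply: subv_trans IHp; rewrite addSn puncturedS; apply/subvP => _ /memv_imgP[F FW ->].
rewrite lfunE /= elsym_shift; apply: memv_suml => T /andP[/subsetP TX _].
by apply: shift_punctured => //; rewrite !ffunE; case: (boolP (z \in T)) => // /TX; rewrite !inE eqxx.
Qed.

(** Two labellings differ by a permutation of the matrix columns, so the scalar is its sign. *)
Lemma generator_relabel d' b : labelling h setT d' ->
  exists a : rat, generator N setT d' b = a *: generator N setT d b.
Proof.
move=> hd'; have [dinj dh dsurj] := hd; have [dinj' dh' _] := hd'.
have ex s : exists t, d t == d' s.
  have [t _ e] := dsurj _ _ (dh' s (in_setT s)).
  by exists t; rewrite e -surjective_pairing.
pose f s := xchoose (ex s); have df s : d (f s) = d' s by apply/eqP/(xchooseP (ex s)).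
have finj : injective f by move=> s t e; apply: dinj'; rewrite ?inE // -!df e.
exists (\det (perm_mx (perm finj)^-1%g)); apply: evP => A.
rewrite evZ !(ev_generator _ _ hN) // mulrC -det_mulmx -col_permE.
congr (\det _); apply/matrixP => s t; rewrite !mxE permE /entry !inE.
by rewrite -[in LHS]df.
Qed.

Lemma generator_source b : b z = j -> generator N setT d b \in sources.
Proof.
move=> bz; suff -> : generator N setT d b = shift [ffun=> 0%N] (generator N setT d b).
  by apply: mem_source; rewrite ?ffunE.
by apply: evP => A; rewrite ev_shift; congr ev; apply/ffunP => s; rewrite !ffunE addn0.
Qed.

Lemma elsym_comm S r e F : elsym S r (shift e F) = shift e (elsym S r F).
Proof.
by rewrite !elsym_shift linear_sum; apply: eq_bigr => T _; rewrite shift_comm.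
Qed.

Lemma generated_punctured k c : (k < h j)%N -> shortest h k c ->
  generated (chop c h) X' (punctured k :&: lker (linfun (elsym X' 1)))%VS.
Proof.
move=> hkj [hk hmin]; have hc0 : (0 < h c)%N by apply: leq_ltn_trans hk.
split=> [d0 b0 hd0|e F he]; rewrite !memv_cap !memv_ker !lfunE /=; last first.
  have ez : e z = 0%N by apply: he; rewrite !inE eqxx.
  by case/andP=> FW /eqP F0; rewrite shift_punctured // elsym_comm F0 linear0 eqxx.
have [_ aG] := annihilated_generator b0 (@bounded_chop _ _ c _ hN) hd0.
rewrite aG // ?setDv ?cards0; last first.
  by rewrite /row_cap big1 // => r _; rewrite min0n.
pose d' s := if s == z then ((h c).-1, c) else d0 s.
pose b' s := if s == z then c else b0 s.
have -> : generator N X' d0 b0 = slice z (h c).-1 (generator N setT d' b').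
  exact: (generator_slice b0 hN (in_setT z) hc0 hd0).
rewrite eqxx andbT.
have [a ->] := generator_relabel b' (labelling_extend (in_setT z) hc0 hd0).
(* The slice is taken at the last row of column [c], which is at least [k], so the smaller space
   [punctured (h c).-1] may serve as target. *)
rewrite linearZ memvZ //; have /punctured_anti/subvP : (k <= (h c).-1)%N by lia.
apply; apply/memv_imgP; exists (generator N setT d b'); rewrite ?lfunE //.
have bz : b' z = c by rewrite /b' eqxx.
have [cj|cj] := eqVneq c j; first by apply: generator_source; rewrite // bz.
(* Since [k < h j] and [c] is a shortest column beyond [k], column [j] is high enough for the
   exchange; [z] then sits in column [j]. *)
rewrite (generator_exchange bz cj (hmin j hkj)) memvN; apply: memv_suml => s /andP[sz _].
by apply: generator_source; rewrite // eq_sym (negbTE sz) eqxx.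
Qed.

(** Rank-nullity for [e_1] on [punctured k]: its image is [punctured k.+1], and the two bounds for
    [chop c h] fix the dimension of its kernel. *)
Lemma dim_puncturedS k : (k < h j)%N ->
  (\dim (punctured k) * row_fact N h =
   row_len h k * m.-1`! + \dim (punctured k.+1) * row_fact N h)%N.
Proof.
move=> hkj; have [c hc] : exists c, shortest h k c.
  by apply: shortestP; apply/card_gt0P; exists j; rewrite inE.
have hc0 : (0 < h c)%N by case: hc => + _; apply: leq_ltn_trans.
rewrite -(limg_ker_dim (linfun (elsym X' 1)) (punctured k)) -puncturedS mulnDl.
congr (_ + _)%N; rewrite (row_fact_chop (hN c) hc) mulnCA; congr (_ * _)%N.
have cX : #|X'| = m.-1.
  by rewrite -[in RHS](card_ord m) -cardsT (cardsD1 z) in_setT.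
have sh : (\sum_c' chop c h c')%N = m.-1 by rewrite sum_chop // sumh.
have bh : bounded N (chop c h) by apply: bounded_chop.
apply/eqP; rewrite eqn_leq (dim_generated cX sh bh) ?andbT; last exact: generated_punctured.
apply: (dim_annihilated cX sh bh) => F.
rewrite memv_cap memv_ker => /andP[/memv_imgP[G GW ->]]; rewrite !lfunE /=.
rewrite elsym_slice_sources // oppr_eq0 => /eqP G0.
exact: (annihilated_slice (annihilated_sources GW) (in_setT z) hc G0).
Qed.

Lemma dim_punctured k : (k <= h j)%N ->
  (\dim (punctured k) * row_fact N h = m.-1`! * \sum_(k <= r < h j) row_len h r)%N.
Proof.
suff main p k' : (k' + p = h j)%N ->
    (\dim (punctured k') * row_fact N h = m.-1`! * \sum_(k' <= r < h j) row_len h r)%N.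
  by move/subnKC/main.
elim: p k' => {k} [|p IHp] k ek.
  rewrite -ek addn0 big_geq // muln0.
  (* Here [k = h j], which exceeds the degree in [z] of every generator with [z] in column [j]. *)
  suff -> : punctured k = 0%VS by rewrite dimv0.
  apply/eqP; rewrite -subv0; apply/subvP => _ /memv_imgP[F FW ->]; rewrite lfunE /= memv0.
  apply/eqP; move: F FW; apply: sources_ind => [|a F G F0 G0|e b ez bz].
  - exact: linear0.
  - by rewrite linearP /= F0 G0 scaler0 addr0.
  by rewrite -shift_slice // (slice_generator_eq0 _ hd) ?linear0 ?inE // bz -ek addn0.
have lt : (k < h j)%N by rewrite -ek; lia.
by rewrite dim_puncturedS // IHp ?addSnnS // [in RHS]big_ltn // mulnDr mulnC.
Qed.

End Punctured.

(** * Lattice determinants *)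

Section Multinom.
Variable n : nat.
Implicit Types (f g : 'I_n -> nat) (m : 'X_{1..n + n}).

Definition mnm_of f g : 'X_{1..n + n} :=
  [multinom match split k with inl s => f s | inr s => g s end | k < n + n].

Lemma mnm_ofl f g s : mnm_of f g (lshift n s) = f s.
Proof. by rewrite mnmE (unsplitK (inl s)). Qed.

Lemma mnm_ofr f g s : mnm_of f g (rshift n s) = g s.
Proof. by rewrite mnmE (unsplitK (inr s)). Qed.

Lemma mnm_ofP m f g : reflect ((forall s, m (lshift n s) = f s) /\ (forall s, m (rshift n s) = g s))
  (mnm_of f g == m).
Proof.
apply: (iffP eqP) => [<-|[hf hg]]; first by split=> s; rewrite ?mnm_ofl ?mnm_ofr.
apply/mnmP => k; rewrite -(splitK k); case: (split k) => s /=.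
  by rewrite mnm_ofl.
by rewrite mnm_ofr.
Qed.

End Multinom.

Section LatticeDet.
Variable D : diagram.
Local Notation n := #|` D|.
Local Notation cell := (fun t : 'I_n => nth (0, 0)%N (cells D) t).
Implicit Types (m e : 'X_{1..n + n}).

Definition cell_mx m : 'M[rat]_n :=
  \matrix_(s, t) ((m (lshift n s), m (rshift n s)) == cell t)%:R.

Lemma mcoeff_lattice_det m : (lattice_det D)@_m = \det (cell_mx m).
Proof.
rewrite /lattice_det /determinant raddf_sum; apply: eq_bigr => sg _ /=.
rewrite (eq_bigr (fun s => xvar s ^+ (cell (sg s)).1 * yvar s ^+ (cell (sg s)).2)); last first.
  by move=> s _; rewrite mxE.
rewrite big_split /=.
have -> : \prod_s xvar s ^+ (cell (sg s)).1 * \prod_s yvar s ^+ (cell (sg s)).2 =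
    'X_[mnm_of (fun s => (cell (sg s)).1) (fun s => (cell (sg s)).2)].
  rewrite mpolyXE_id big_split_ord /=; congr (_ * _); apply: eq_bigr => s _.
    by rewrite mnm_ofl.
  by rewrite mnm_ofr.
have -> (p : {mpoly rat[n + n]}) : ((-1) ^+ sg * p)@_m = (-1) ^+ sg * p@_m.
  by case: (odd_perm sg); rewrite ?expr0 ?expr1 ?mul1r ?mulN1r ?mcoeffN.
rewrite mcoeffX; congr (_ * _).
case: mnm_ofP => [[hl hr]|hm].
  by rewrite big1 // => s _; rewrite mxE hl hr -surjective_pairing eqxx.
apply/esym/eqP; apply: contra_notT hm => /prodf_neq0 /= h.
split=> s; by have := h s isT; rewrite mxE pnatr_eq0 eqb0 negbK => /eqP<-.
Qed.

Lemma lattice_det_support m : (lattice_det D)@_m != 0 ->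
  exists sg : {perm 'I_n}, forall s, (m (lshift n s), m (rshift n s)) = cell (sg s).
Proof.
rewrite mcoeff_lattice_det => /det_support[sg h]; exists sg => s.
by have := h s; rewrite mxE pnatr_eq0 eqb0 negbK => /eqP.
Qed.

(** The product of the factorials of the exponents, common to all monomials of the determinant. *)
Definition cells_fact : rat := \prod_(t < n) ((cell t).1`! * (cell t).2`!)%:R.

Lemma cells_fact_neq0 : cells_fact != 0.
Proof. by apply/prodf_neq0 => t _; rewrite pnatr_eq0 -lt0n muln_gt0 !fact_gt0. Qed.

Lemma ydeg_cells m : (lattice_det D)@_m != 0 -> ydeg m = (\sum_t (cell t).2)%N.
Proof.
case/lattice_det_support=> sg h; rewrite [RHS](reindex_inj (@perm_inj _ sg)).
by apply: eq_bigr => s _; rewrite -h.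
Qed.

Lemma ydegD m e : ydeg (m + e)%MM = (ydeg m + ydeg e)%N.
Proof. by rewrite -big_split; apply: eq_bigr => s _; rewrite /= mnmDE. Qed.

Lemma mcoeff_mderivm_det e m : ydeg m = 0%N ->
  ((lattice_det D)^`M[e])@_m =
  cells_fact / (\prod_s (m (lshift n s))`!%:R) * (lattice_det D)@_(e + m).
Proof.
move=> ym; rewrite mcoeff_mderivm.
have [->|nz] := eqVneq ((lattice_det D)@_(e + m)) 0; first by rewrite mul0rn mulr0.
have [sg h] := lattice_det_support nz.
rewrite -mulr_natl; congr (_ * _).
have mr s : m (rshift n s) = 0%N.
  by move/eqP: ym; rewrite sum_nat_eq0 => /forallP/(_ s)/implyP/(_ isT)/eqP.
have -> : cells_fact = \prod_k ((e + m)%MM k)`!%:R.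
  rewrite big_split_ord /= -big_split /cells_fact /= (reindex_inj (@perm_inj _ sg)) /=.
  by apply: eq_bigr => s _; rewrite -h natrM.
have -> : \prod_s (m (lshift n s))`!%:R = \prod_k (m k)`!%:R :> rat.
  rewrite [RHS]big_split_ord /= [X in _ = _ * X]big1 ?mulr1 // => s _.
  by rewrite mr.
rewrite -prodf_div rmorph_prod; apply: eq_bigr => k _ /=.
have le : (e k <= (e + m)%MM k)%N by rewrite mnmDE leq_addr.
apply/(canRL (mulfK _)); first by rewrite pnatr_eq0 -lt0n fact_gt0.
by rewrite -natrM; congr _%:R; rewrite -(ffact_fact le) mnmDE addKn.
Qed.

Lemma M_space_lin a p q : M_space D p -> M_space D q -> M_space D (a *: p + q).
Proof.
move=> [N1 [a1 [e1 ->]]] [N2 [a2 [e2 ->]]].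
exists (N1 + N2)%N, (fun k => match split k with inl k => a * a1 k | inr k => a2 k end).
exists (fun k => match split k with inl k => e1 k | inr k => e2 k end).
rewrite big_split_ord scaler_sumr /=; congr (_ + _); apply: eq_bigr => k _.
  by rewrite (unsplitK (inl k)) scalerA.
by rewrite (unsplitK (inr k)).
Qed.

Lemma M_space0 : M_space D 0.
Proof. by exists 0%N, (fun=> 0), (fun=> 0%MM); rewrite big_ord0. Qed.

Lemma M_space_deriv e : M_space D (lattice_det D)^`M[e].
Proof. by exists 1%N, (fun=> 1), (fun=> e); rewrite big_ord1 scale1r. Qed.

End LatticeDet.

(** * From normalized coefficients to polynomials free of [Y] *)

Section Realization.
Variables (n N : nat).
Local Notation coeffs := (coeffs n.+1 N).
Local Notation z := (@ord0 n).
Implicit Types (F : coeffs) (m : 'X_{1..n + n}).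
Implicit Types (A : expo n.+1).

(* [ydeg] is only available when the number of variables is the size of a diagram. *)
Definition ydegree m : nat := (\sum_(s < n) m (rshift n s))%N.

(** The variable [ord0] is kept for the removed cell, and [lift z s] stands for [x_s]. *)
Definition xpart m : expo n.+1 :=
  [ffun s => if unlift z s is Some t then m (lshift n t) else 0%N].

Lemma xpart0 m : xpart m z = 0%N.
Proof. by rewrite ffunE unlift_none. Qed.

Lemma xpart_lift m s : xpart m (lift z s) = m (lshift n s).
Proof. by rewrite ffunE liftK. Qed.

Definition xmnm (A : expo n.+1) : 'X_{1..n + n} :=
  mnm_of (fun s => A (lift z s)) (fun=> 0%N).

Lemma xpart_xmnm A : A z = 0%N -> xpart (xmnm A) = A.
Proof.
move=> Az; apply/ffunP => s; case: (unliftP z s) => [t|] ->; last by rewrite xpart0.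
by rewrite xpart_lift mnm_ofl.
Qed.

Lemma xmnm_xpart m : ydegree m = 0%N -> xmnm (xpart m) = m.
Proof.
move/eqP; rewrite sum_nat_eq0 => /forallP h0; apply/eqP/mnm_ofP; split=> s.
  by rewrite xpart_lift.
exact/eqP/(implyP (h0 s)).
Qed.

Lemma ydegree_xmnm A : ydegree (xmnm A) = 0%N.
Proof. by apply: big1 => s _; rewrite mnm_ofr. Qed.

(* Undoes the normalization of [coeffs], in which derivations are shifts. *)
Definition realize F : {mpoly rat[n + n]} :=
  \sum_(a : {ffun 'I_n.+1 -> 'I_N.+1} | a z == ord0)
    ((F a : rat) / \prod_s (a (lift z s))`!%:R) *: 'X_[xmnm [ffun s => a s : nat]].

Lemma realize_linear : linear realize.
Proof.
move=> a F G; rewrite scaler_sumr -big_split; apply: eq_bigr => s _ /=.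
by rewrite !ffunE scalerA -scalerDl mulrDl mulrA.
Qed.
HB.instance Definition _ :=
  GRing.isLinear.Build rat coeffs {mpoly rat[n + n]} _ realize realize_linear.

Lemma mcoeff_realize F m :
  (realize F)@_m = if ydegree m == 0%N then ev F (xpart m) / \prod_s (m (lshift n s))`!%:R
                   else 0.
Proof.
rewrite raddf_sum /=; under eq_bigr do rewrite mcoeffZ mcoeffX.
case: (ydegree m =P 0%N) => [ym|ym]; last first.
  by rewrite big1 // => a _; case: eqP ym => [<-|_]; rewrite ?ydegree_xmnm ?mulr0.
rewrite /ev; case: ifPn => [/in_boxP mb|mb]; last first.
  rewrite mul0r big1 // => a /eqP az; case: eqP => [em|_]; last by rewrite mulr0.
  case/negP: mb; apply/in_boxP => s; rewrite -em xpart_xmnm ?ffunE ?az //.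
  by rewrite -ltnS.
pose a0 : {ffun 'I_n.+1 -> 'I_N.+1} := [ffun s => inord (xpart m s)].
have a0E : [ffun s => a0 s : nat] = xpart m.
  by apply/ffunP => s; rewrite [LHS]ffunE [a0 s]ffunE inordK // ltnS.
rewrite (bigD1 a0) /=; last by rewrite ffunE xpart0 -val_eqE /= inordK.
rewrite a0E xmnm_xpart // eqxx mulr1 [X in _ + X]big1 ?addr0 => [|a /andP[/eqP az na]]; last first.
  case: eqP => [em|_]; last by rewrite mulr0.
  case/eqP: na; apply/ffunP => s; apply/val_inj.
  have : xpart m s = a s by rewrite -em xpart_xmnm ?ffunE ?az.
  by rewrite [a0 s]ffunE => ->; rewrite inord_val.
congr (_ / _); apply: eq_bigr => s _; congr (_`!%:R).
by rewrite -xpart_lift -a0E [RHS]ffunE.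
Qed.

Lemma realize_inj F : (forall A, A z != 0%N -> ev F A = 0) -> realize F = 0 -> F = 0.
Proof.
move=> Fz F0; apply: evP => A; rewrite ev0; have [Az|] := eqVneq (A z) 0%N; last exact: Fz.
have := congr1 (fun p : {mpoly rat[n + n]} => p@_(xmnm A)) F0.
rewrite mcoeff_realize ydegree_xmnm eqxx mcoeff0 xpart_xmnm // => /eqP.
rewrite mulf_eq0 invr_eq0 => /orP[/eqP//|/prodf_eq0[s _]].
by rewrite pnatr_eq0 -leqn0 leqNgt fact_gt0.
Qed.

End Realization.

(** * The [Y]-free component as a punctured space *)

Section Transfer.
Variables (D : diagram) (N C i : nat) (h : {ffun 'I_C.+1 -> nat}) (j : 'I_C.+1).
Local Notation n := #|` D|.
Local Notation z := (@ord0 n).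
Variable d : 'I_n.+1 -> nat * 'I_C.+1.
Local Notation cell := (fun t : 'I_n => nth (0, 0)%N (cells D) t).
Hypotheses (hN : bounded N h) (hd : labelling h setT d) (dz : d z = (i, j)).
Hypothesis dl : forall t, cell t = ((d (lift z t)).1, (d (lift z t)).2 : nat).
Implicit Types (m : 'X_{1..n + n}) (A : expo n.+1).

Lemma ev_slice_generator b A : b z = j -> A z = 0%N ->
  ev (slice z i (generator N setT d b)) A =
  \det (\matrix_(s, t) ((A (lift z s), b (lift z s) : nat) == cell t)%:R).
Proof.
move=> bz Az; rewrite ev_slice Az eqxx (ev_generator _ _ hN hd).
have [dinj _ _] := hd.
rewrite (expand_det_row _ z) (bigD1 z) //= big1 ?addr0 => [|t tz]; last first.
  rewrite !mxE /entry !inE /= ffunE eqxx bz -dz; case: eqP => [/dinj e|_]; last by rewrite mul0r.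
  by rewrite -e ?inE ?eqxx in tz.
rewrite mxE /entry !inE /= ffunE eqxx bz dz eqxx mul1r /cofactor addnn -signr_odd odd_double mul1r.
congr (\det _); apply/matrixP => s t; rewrite !mxE /entry !inE /= ffunE.
rewrite [lift z s == z]eq_sym (negbTE (neq_lift _ _)) dl; case: (d (lift z t)) => r c /=.
by rewrite !xpair_eqE.
Qed.

(** A [Y]-free term survives the derivation only if the exponent of each [y_s] is exactly the order
    of derivation, which thus prescribes the column of the variable [s]. *)
Definition ycols m : 'I_n.+1 -> 'I_C.+1 :=
  fun s => if unlift z s is Some t then inord (m (rshift n t)) else j.

(* The counterpart in [coeffs] of the derivative of the lattice determinant of
   multi-exponent [e], up to the components involving [Y]. *)
Definition yfree_source (e : 'X_{1..n + n}) : coeffs n.+1 N :=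
  if [forall s, e (rshift n s) <= C]%N
  then slice z i (shift (xpart e) (generator N setT d (ycols e))) else 0.

Lemma mcoeff_deriv_source e m : ydeg m = 0%N ->
  ((lattice_det D)^`M[e])@_m = cells_fact D * (realize (yfree_source e))@_m.
Proof.
move=> ym; rewrite mcoeff_mderivm_det // mcoeff_realize /ydegree -/(ydeg m) ym eqxx.
rewrite -[LHS]mulrA; congr (_ * _); rewrite [LHS]mulrC; congr (_ / _).
have mr s : m (rshift n s) = 0%N.
  by move/eqP: ym; rewrite sum_nat_eq0 => /forallP/(_ s)/implyP/(_ isT)/eqP.
rewrite /yfree_source; case: ifPn => [/forallP eC|/forallPn[s eC]]; last first.
  (* No cell lies in a column beyond [C], so such a derivative has no [Y]-free term. *)
  rewrite ev0; apply/eqP; apply: contraNT eC => /lattice_det_support[sg h'].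
  have := congr1 snd (h' s); rewrite [RHS]/= dl /= mnmDE mr addn0 => ->; rewrite -ltnS; exact: ltn_ord.
rewrite -shift_slice ?xpart0 // ev_shift ev_slice_generator; first last.
- by rewrite ffunE !xpart0.
- by rewrite /ycols unlift_none.
rewrite mcoeff_lattice_det; congr (\det _); apply/matrixP => s t; rewrite !mxE.
rewrite !mnmDE mr addn0 ffunE !xpart_lift addnC /ycols liftK inordK // ltnS; exact: eC.
Qed.

Lemma yfree_source_punctured e : yfree_source e \in punctured N z d j i.
Proof.
rewrite /yfree_source; case: ifP => _; last exact: mem0v.
apply/memv_imgP; exists (shift (xpart e) (generator N setT d (ycols e))); rewrite ?lfunE //.
by apply: mem_source; rewrite ?xpart0 // /ycols unlift_none.
Qed.

Lemma realize_punctured F : F \in punctured N z d j i -> M0_space D (realize F).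
Proof.
case/memv_imgP=> G GW ->; rewrite lfunE /=; split; last first.
  move=> m; rewrite mcoeff_msupp mcoeff_realize -/(ydeg m).
  by case: (ydeg m =P 0%N) => // _; rewrite eqxx.
move: G GW; apply: sources_ind => [|a F1 F2 M1 M2|e b ez bz].
- by rewrite !linear0; apply: M_space0.
- by rewrite !linearP; apply: M_space_lin.
pose e' := mnm_of (fun s => e (lift z s)) (fun s => b (lift z s) : nat).
have eE : xpart e' = e.
  apply/ffunP => s; case: (unliftP z s) => [t|] ->; last by rewrite xpart0.
  by rewrite xpart_lift mnm_ofl.
have bE : ycols e' =1 b.
  move=> s; rewrite /ycols; case: (unliftP z s) => [t|] ->; last by rewrite bz.
  by rewrite mnm_ofr inord_val.
have srcE : slice z i (shift e (generator N setT d b)) = yfree_source e'.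
  rewrite /yfree_source; case: forallP => [_|[]]; last first.
    by move=> s; rewrite mnm_ofr -ltnS.
  by rewrite eE; congr (slice _ _ (shift _ _)); apply: eq_generator.
(* The determinant is homogeneous in [Y]: if the order in [Y] equals its degree, the derivative is
   wholly [Y]-free; otherwise its [Y]-free component is zero. *)
have [ye|ye] := eqVneq (ydeg e') (\sum_t (cell t).2)%N.
  have -> : realize (slice z i (shift e (generator N setT d b))) =
      (cells_fact D)^-1 *: (lattice_det D)^`M[e'] + 0.
    rewrite addr0; apply/mpolyP => m; rewrite mcoeffZ srcE.
    have [ym|ym] := eqVneq (ydeg m) 0%N.
      by rewrite mcoeff_deriv_source // mulKf // cells_fact_neq0.
    rewrite mcoeff_realize (negbTE ym) mcoeff_mderivm.
    suff -> : (lattice_det D)@_(e' + m) = 0 by rewrite mul0rn mulr0.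
    apply/eqP; apply: contraNT ym => /ydeg_cells; rewrite ydegD ye.
    by move/eqP; rewrite -[X in _ == X]addn0 eqn_add2l.
  by apply: M_space_lin; [apply: M_space_deriv|apply: M_space0].
suff -> : realize (slice z i (shift e (generator N setT d b))) = 0 by apply: M_space0.
apply/mpolyP => m; rewrite mcoeff0 srcE.
have [ym|ym] := eqVneq (ydeg m) 0%N; last by rewrite mcoeff_realize (negbTE ym).
apply: (mulfI (cells_fact_neq0 D)); rewrite -mcoeff_deriv_source // mulr0 mcoeff_mderivm.
suff -> : (lattice_det D)@_(e' + m) = 0 by rewrite mul0rn.
by apply/eqP; apply: contraNT ye => /ydeg_cells; rewrite ydegD ym addn0 => ->.
Qed.

Lemma M0_spaceP p : M0_space D p ->
  exists2 F, F \in punctured N z d j i & p = realize F.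
Proof.
case=> [[K [a [e ->]]] yfree].
exists (\sum_(k < K) (a k * cells_fact D) *: yfree_source (e k)).
  by apply: memv_suml => k _; rewrite memvZ ?yfree_source_punctured.
apply/mpolyP => m; have [ym|ym] := eqVneq (ydeg m) 0%N.
  have -> : realize (\sum_(k < K) (a k * cells_fact D) *: yfree_source (e k)) =
      \sum_(k < K) (a k * cells_fact D) *: realize (yfree_source (e k)).
    by rewrite linear_sum; apply: eq_bigr => k _; rewrite linearZ.
  rewrite [LHS](raddf_sum (mcoeff m)) [RHS](raddf_sum (mcoeff m)).
  by apply: eq_bigr => k _ /=; rewrite !mcoeffZ mcoeff_deriv_source // mulrA.
rewrite [RHS]mcoeff_realize (negbTE ym); apply: memN_msupp_eq0.
by apply: contra ym => /yfree->.
Qed.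

Lemma M0_space_dim : is_dim (M0_space D) (\dim (punctured N z d j i)).
Proof.
set W := punctured N z d j i.
exists (fun k => realize (vbasis W)`_k); split=> [a|p].
  under eq_bigr do rewrite -linearZ; rewrite -linear_sum => /realize_inj.
  set F := \sum_(k < _) _; have FW : F \in W.
    apply: memv_suml => k _; rewrite memvZ // vbasis_mem // mem_nth //.
    by rewrite size_tuple.
  have Fz A : A z != 0%N -> ev F A = 0.
    case/memv_imgP: FW => G _ ->; rewrite lfunE /= ev_slice => /negbTE-> //.
  move/(_ Fz) => F0; have /freeP := basis_free (vbasisP W); exact.
split=> [/M0_spaceP[F FW ->]|[a ->]].
  exists (fun k => coord (vbasis W) k F).
  by rewrite {1}(coord_vbasis FW) linear_sum; apply: eq_bigr => k _; rewrite linearZ.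
under eq_bigr do rewrite -linearZ; rewrite -linear_sum; apply: realize_punctured.
apply: memv_suml => k _; rewrite memvZ // vbasis_mem // mem_nth //.
by rewrite size_tuple.
Qed.

End Transfer.

(** * Partitions, their column heights and the labelling of their cells *)

Lemma ltn_nth_count (mu : seq nat) r c : sorted geq mu ->
  (c < nth 0 mu r)%N = (r < count (fun k => c < k) mu)%N.
Proof.
elim: mu r => [|k mu IHmu] r; first by rewrite nth_nil.
move=> /= smu; have [le_ck|lt_ck] := leqP k c; last first.
  by case: r => [|r] //=; rewrite IHmu ?(path_sorted smu).
have c0 : count (fun k => c < k)%N mu = 0%N.
  apply/eqP; rewrite -leqn0 leqNgt -has_count; apply/hasPn => k' /=.
  have /allP h := order_path_min (rev_trans leq_trans) smu.
  by move/h => /= le; rewrite -leqNgt (leq_trans le).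
rewrite /= add0n; case: r => [|r] /=; rewrite c0; first by lia.
by rewrite IHmu ?(path_sorted smu) // c0.
Qed.

Lemma mem_part_diagram mu r c : ((r, c) \in part_diagram mu) = (c < nth 0 mu r)%N.
Proof.
rewrite inE; apply/allpairsPdep/idP => [[r' [c' [_ + [-> ->]]]]|hc].
  by rewrite mem_iota.
exists r, c; rewrite !mem_iota !add0n; split=> //=.
by have [//|le] := ltnP r (size mu); rewrite nth_default in hc.
Qed.

Lemma card_rows mu a p :
  #|` [fset rc in [seq (r, c) | r <- iota a p, c <- iota 0 (nth 0%N mu r)]]%fset| =
  (\sum_(a <= r < a + p) nth 0 mu r)%N.
Proof.
rewrite card_fseq undup_id; last first.
  apply: allpairs_uniq_dep => [|r _|]; rewrite ?iota_uniq //.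
  by case=> [r c] [r' c'] _ _ [/= -> ->].
rewrite size_allpairs_dep sumnE big_map /index_iota addKn.
by apply: eq_bigr => r _; rewrite size_iota.
Qed.

Lemma sumn_nth mu p : (size mu <= p)%N -> (\sum_(k < p) nth 0 mu k = sumn mu)%N.
Proof.
move=> lep; rewrite sumnE (big_nth 0%N) -(big_mkord xpredT (nth 0%N mu)).
rewrite (big_cat_nat (leq0n _) lep) //= [X in (_ + X)%N]big_nat_cond [X in (_ + X)%N]big1 ?addn0 //.
by move=> k /andP[/andP[le _] _]; rewrite nth_default.
Qed.

Lemma card_punctured_diagram n mu i j : is_partition mu n.+1 ->
  (i, j) \in part_diagram mu -> #|` (part_diagram mu `\ (i, j))%fset| = n.
Proof.
case=> _ _ smu hij; have := cardfsD1 (i, j) (part_diagram mu).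
rewrite hij card_rows add0n big_mkord sumn_nth // smu => -[->] //.
Qed.

(** The conjugate partition, padded with empty columns: no row of a partition of [n.+1] is longer
    than [n.+1]. *)
Definition heights n mu : {ffun 'I_n.+1 -> nat} :=
  [ffun c : 'I_n.+1 => count (fun k => c < k)%N mu].

Lemma row_len_heights n mu r : is_partition mu n.+1 -> row_len (heights n mu) r = nth 0%N mu r.
Proof.
case=> mus _ smu; have le : (nth 0 mu r <= n.+1)%N.
  rewrite -smu; have [lt|le] := ltnP r (size mu); last by rewrite nth_default.
  by rewrite -(sumn_nth (leqnn _)) (bigD1 (Ordinal lt)) //= leq_addr.
rewrite /row_len -sum1_card big_mkcond /= -[RHS](minn_idPr le) -sum_ord_lt.
by apply: eq_bigr => c _; rewrite inE ffunE -ltn_nth_count //; case: ltnP.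
Qed.

Section Labelling.
Variables (n : nat) (mu : seq nat) (i j : nat).
Hypotheses (hmu : is_partition mu n.+1) (hij : (i, j) \in part_diagram mu).
Local Notation D := (part_diagram mu `\ (i, j))%fset.
Local Notation p := #|` D|.
Local Notation z := (@ord0 p).

Definition raw_label (s : 'I_p.+1) : nat * nat :=
  if unlift z s is Some t then nth (0, 0)%N (cells D) t else (i, j).

Definition label (s : 'I_p.+1) : nat * 'I_n.+1 := ((raw_label s).1, inord (raw_label s).2).

Lemma mem_cells rc : (rc \in cells D) = (rc \in D).
Proof. by rewrite mem_sort. Qed.

Lemma size_cells : size (cells D) = p.
Proof. by rewrite size_sort. Qed.

Lemma uniq_cells : uniq (cells D).
Proof. by rewrite sort_uniq fset_uniq. Qed.

Lemma nth_cells (t : 'I_p) : nth (0, 0)%N (cells D) t \in D.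
Proof. by rewrite -mem_cells mem_nth // size_cells. Qed.

Lemma raw_label_part s : raw_label s \in part_diagram mu.
Proof.
rewrite /raw_label; case: (unlift z s) => [t|] //.
by have := nth_cells t; rewrite !inE => /andP[].
Qed.

Lemma raw_label_inj : injective raw_label.
Proof.
have nij t : nth (0, 0)%N (cells D) (t : 'I_p) != (i, j).
  by have := nth_cells t; rewrite in_fsetD1 => /andP[].
move=> s t; rewrite /raw_label; case: (unliftP z s) => [s'|] ->; case: (unliftP z t) => [t'|] -> //.
- move/eqP; rewrite nth_uniq ?size_cells ?uniq_cells // => /eqP e.
  by congr lift; apply: val_inj.
- by move=> e; case/eqP: (nij s').
by move=> e; case/eqP: (nij t').
Qed.

Lemma part_col r c : (r, c) \in part_diagram mu -> (c < n.+1)%N.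
Proof.
rewrite mem_part_diagram => /leq_trans; apply; rewrite -(row_len_heights r hmu).
by rewrite -[X in (_ <= X)%N](card_ord n.+1) max_card.
Qed.

Lemma raw_label2 s : (label s).2 = (raw_label s).2 :> nat.
Proof.
rewrite inordK //; have := raw_label_part s; case: (raw_label s) => r c; exact: part_col.
Qed.

Lemma labelling_label : labelling (heights n mu) setT label.
Proof.
have [mus _ _] := hmu; split=> [s t _ _ e|s _|c r].
- apply: raw_label_inj; have e2 : (raw_label s).2 = (raw_label t).2 by rewrite -!raw_label2 e.
  have [e1 _] := e; rewrite (surjective_pairing (raw_label s)) e1 e2.
  by rewrite -surjective_pairing.
- rewrite ffunE raw_label2 /= -ltn_nth_count // -mem_part_diagram -surjective_pairing.
  exact: raw_label_part.
rewrite ffunE -ltn_nth_count // -mem_part_diagram => rc.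
suff [s es] : exists s, raw_label s = (r, c : nat).
  by exists s; rewrite ?inE // /label es /= inord_val.
have [->|ne] := eqVneq (r, c : nat) (i, j).
  by exists z; rewrite /raw_label unlift_none.
have rcD : (r, c : nat) \in cells D by rewrite mem_cells in_fsetD1 ne.
have lt : (index (r, c : nat) (cells D) < p)%N by rewrite -size_cells index_mem.
by exists (lift z (Ordinal lt)); rewrite /raw_label liftK /= nth_index.
Qed.

End Labelling.

Theorem mainTheorem3 (n : nat) (mu : seq nat) (i j l : nat)
  (hmu : is_partition mu n.+1)
  (hij : (i, j) \in part_diagram mu)
  (hl : (l, j) \in part_diagram mu)
  (hlmax : forall r : nat, (r, j) \in part_diagram mu -> (r <= l)%N) :
  exists d : nat,
    is_dim (M0_space (part_diagram mu `\ (i, j))%fset) d /\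
    d%:R = n`!%:R / (part_fact mu)%:R *
           #|` [fset rc in part_diagram mu | (i <= rc.1 <= l)%N]%fset |%:R :> rat.
Proof.
have [mus _ smu] := hmu; have cD := card_punctured_diagram hmu hij.
have hd := labelling_label hmu hij; set d := @label n mu i j in hd.
set h := heights n mu in hd.
(* No column is higher than [size mu], so all exponents fit in the box. *)
pose N := size mu; pose jo : 'I_n.+1 := inord j.
have joE : jo = j :> nat by rewrite inordK // (part_col hmu hij).
have hN : bounded N h by move=> c; rewrite ffunE (leq_trans (count_size _ _)) // leqnSn.
have sumh : (\sum_c h c)%N = #|` (part_diagram mu `\ (i, j))%fset|.+1.
  rewrite -(sum_row_len hN) cD -[RHS]smu -(sumn_nth (leqnSn (size mu))).
  by apply: eq_bigr => k _; rewrite row_len_heights.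
have hjo : h jo = l.+1.
  have hmem r : (r < h jo)%N = ((r, j) \in part_diagram mu).
    by rewrite ffunE joE -ltn_nth_count // mem_part_diagram.
  apply/eqP; rewrite eqn_leq hmem hl andbT leqNgt hmem.
  by apply/negP => /hlmax; rewrite ltnn.
have dz : d ord0 = (i, jo) by rewrite /d /label /raw_label unlift_none.
exists (\dim (punctured N ord0 d jo i)); split.
  apply: (M0_space_dim hN hd dz) => t.
  rewrite raw_label2 // /= -surjective_pairing.
  by rewrite /raw_label liftK.
have ile : (i <= h jo)%N by rewrite hjo ltnW // ltnS; apply: hlmax.
have := @dim_punctured _ N _ h ord0 d jo hN hd sumh i ile.
move: (\dim _) => w; rewrite /= cD hjo.
have -> : row_fact N h = part_fact mu.
  (* [row_fact] runs over one row more than [mu] has; that row is empty and contributes [0! = 1]. *)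
  rewrite /part_fact (big_nth 0%N) big_mkord /row_fact big_ord_recr /=.
  rewrite row_len_heights // nth_default // muln1.
  by apply: eq_bigr => k _; rewrite row_len_heights.
have -> : (\sum_(i <= r < l.+1) row_len h r)%N =
    #|` [fset rc in part_diagram mu | (i <= rc.1 <= l)%N]%fset |.
  rewrite (eq_bigr (nth 0%N mu)) => [|r _]; last by rewrite row_len_heights.
  have -> : l.+1 = (i + (l.+1 - i))%N by rewrite subnKC //; apply: leqW; apply: hlmax.
  rewrite -card_rows; congr #|` _ |; apply/fsetP => -[r c].
  have := mem_part_diagram mu r c; rewrite !inE /= => ->.
  apply/allpairsPdep/idP => [[r' [c' [hr hc [-> ->]]]]|/andP[hc hr]].
    by move: hr hc; rewrite !mem_iota; lia.
  by exists r, c; rewrite !mem_iota; split=> //; lia.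
move/(congr1 (fun k => k%:R : rat)); rewrite !natrM => e.
have pf0 : (part_fact mu)%:R != 0 :> rat.
  by rewrite pnatr_eq0 -lt0n prodn_gt0 // => k; apply: fact_gt0.
by apply: (mulIf pf0); rewrite e mulrAC divfK.
Qed.
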